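(* Let $C$ and $C'$ be two cocomplete differential graded coalgebras and $f,g:C\to C'$ two morphisms of differential graded coalgebras. (a) If $f$ and $g$ are homotopic in the classical sense, then they are left homotopic in the model category $\mathrm{Cogc}$. (b) If the coalgebra $C'$ is fibrant in $\mathrm{Cogc}$, then $f$ and $g$ are homotopic in the classical sense if and only if they are left homotopic.
   Context: Base category: $\mathbb K$ is a field; $\mathsf C$ is a $\mathbb K$-linear abelian category which is semisimple, cocomplete and has exact filtered colimits, with a $\mathbb K$-bilinear monoidal structure $(\otimes,e)$ such that for every $X$ the functors $X\otimes-$ and $-\otimes X$ are exact and commute with filtered colimits. Graded objects are $\mathbb Z$-graded objects of $\mathsf C$, differentials have degree $+1$, Koszul sign rule; $(SM)^i=M^{i+1}$, $s:M\to SM$ canonical of degree $-1$, $\omega=s^{-1}$. $\mathrm{Cogc}$ is the category of cocomplete dg coalgebras (coassociative, not necessarily counital, $C=\mathrm{colim}_n\ker(\Delta^{(n+1)}:C\to C^{\otimes n+1})$). It is a model category with: weak equivalences the morphisms $f$ such that $\Omega f$ is a quasi-isomorphism, where the cobar construction $\Omega C=\bigoplus_{i\ge1}(S^{-1}C)^{\otimes i}$ is the reduced tensor algebra with the derivation whose restriction to $S^{-1}C$ has components $-\omega ds$ and $-\omega^{\otimes2}\Delta s$; cofibrations the monomorphisms of underlying complexes; fibrations the morphisms with the right lifting property with respect to the cofibrations which are weak equivalences. Classical homotopy: $f,g:C\to C'$ are homotopic in the classical sense if there is a morphism $h:C\to C'$ of degree $-1$ with $\Delta h=(f\otimes h+h\otimes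 g)\Delta$ (an $(f,g)$-coderivation) and $dh+hd=f-g$. Left homotopy: a cylinder for $X$ is an object $X\wedge I$ with morphisms $i:X\coprod X\to X\wedge I$, $p:X\wedge I\to X$ such that $p$ is a weak equivalence and $p\circ i=[\mathbf 1,\mathbf 1]$; $f,g:X\to Y$ are left homotopic if for some cylinder $X\wedge I$ the morphism $[f,g]:X\coprod X\to Y$ factors through $i$. (It is not required that $i$ be a cofibration.) *)

(* Defs.v *)
From HB Require Import structures.
From mathcomp Require Import all_boot all_order all_algebra.
From mathcomp Require Import boolp.

Set Implicit Arguments.
Unset Strict Implicit.
Unset Printing Implicit Defensive.

Import GRing.Theory.
Local Open Scope ring_scope.

Declare Scope lincat_scope.
Delimit Scope lincat_scope with lincat.
Local Open Scope lincat_scope.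

Record lincat (K : fieldType) := LinCat {
  ob :> Type;
  hom : ob -> ob -> lmodType K;
  idm : forall X, hom X X;
  compm : forall X Y Z, hom Y Z -> hom X Y -> hom X Z;
  compA : forall W X Y Z (h : hom Y Z) (g : hom X Y) (f : hom W X),
    compm h (compm g f) = compm (compm h g) f;
  comp1m : forall X Y (f : hom X Y), compm (idm Y) f = f;
  compm1 : forall X Y (f : hom X Y), compm f (idm X) = f;
  comp_linearr : forall X Y Z (g : hom Y Z),
    linear (fun f : hom X Y => compm g f : hom X Z);
  comp_linearl : forall X Y Z (f : hom X Y),
    linear (fun g : hom Y Z => compm g f : hom X Z)
}.
Arguments hom {K l} _ _.
Arguments idm {K l} _.
Arguments compm {K l X Y Z} _ _.

Notation "X ~> Y" := (hom X Y) (at level 70, no associativity) : lincat_scope.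
Notation "g ∘ f" := (compm g f) (at level 40, left associativity) : lincat_scope.

Section LinCatDefs.
Variables (K : fieldType) (C : lincat K).
Implicit Types X Y Z W : C.

Definition monic X Y (f : X ~> Y) :=
  forall W (u v : W ~> X), f ∘ u = f ∘ v -> u = v.
Definition epic X Y (f : X ~> Y) :=
  forall W (u v : Y ~> W), u ∘ f = v ∘ f -> u = v.
Definition is_iso X Y (f : X ~> Y) :=
  exists g : Y ~> X, g ∘ f = idm X /\ f ∘ g = idm Y.

Definition is_zero_ob Z :=
  forall X, (forall f : X ~> Z, f = 0) /\ (forall f : Z ~> X, f = 0).

Definition is_biproduct X Y S :=
  exists (i1 : X ~> S) (i2 : Y ~> S) (p1 : S ~> X) (p2 : S ~> Y),
    [/\ p1 ∘ i1 = idm X, p2 ∘ i2 = idm Y, p1 ∘ i2 = 0, p2 ∘ i1 = 0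
      & i1 ∘ p1 + i2 ∘ p2 = idm S].

Definition is_kernel X Y Z (k : X ~> Y) (f : Y ~> Z) :=
  f ∘ k = 0 /\
  forall W (u : W ~> Y), f ∘ u = 0 -> exists! v : W ~> X, k ∘ v = u.
Definition is_cokernel X Y Z (q : Y ~> Z) (f : X ~> Y) :=
  q ∘ f = 0 /\
  forall W (u : Y ~> W), u ∘ f = 0 -> exists! v : Z ~> W, v ∘ q = u.

Record abelian : Prop := Abelian {
  ab_zero : exists Z, is_zero_ob Z;
  ab_biproduct : forall X Y, exists S, is_biproduct X Y S;
  ab_kernel : forall Y Z (f : Y ~> Z), exists X (k : X ~> Y), is_kernel k f;
  ab_cokernel : forall X Y (f : X ~> Y), exists Z (q : Y ~> Z), is_cokernel q f;
  ab_monic : forall X Y (f : X ~> Y), monic f ->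
    exists Z (g : Y ~> Z), is_kernel f g;
  ab_epic : forall X Y (f : X ~> Y), epic f ->
    exists W (g : W ~> X), is_cokernel f g
}.

Definition short_exact X Y Z (i : X ~> Y) (p : Y ~> Z) :=
  is_kernel i p /\ is_cokernel p i.

Definition semisimple := forall X Y Z (i : X ~> Y) (p : Y ~> Z),
  short_exact i p -> exists r : Y ~> X, r ∘ i = idm X.

End LinCatDefs.

(* A record separate from lincat, so that the size of the index categories is
   independent of the size of the categories in which colimits are taken. *)
Record smallcat := SmallCat {
  sob :> Type;
  shom : sob -> sob -> Type;
  sid : forall i, shom i i;
  scomp : forall i j k, shom j k -> shom i j -> shom i k;
  scompA : forall i j k l (h : shom k l) (g : shom j k) (f : shom i j),
    scomp h (scomp g f) = scomp (scomp h g) f;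
  scomp1m : forall i j (f : shom i j), scomp (sid j) f = f;
  scompm1 : forall i j (f : shom i j), scomp f (sid i) = f
}.

Definition filtered (J : smallcat) :=
  [/\ inhabited J,
      forall i j : J, exists (k : J) (u : shom i k) (v : shom j k), True
    & forall (i j : J) (u v : shom i j),
        exists (k : J) (w : shom j k), scomp w u = scomp w v].

Section Colimits.
Variables (K : fieldType) (C : lincat K).

Record diagram (J : smallcat) := Diagram {
  dob :> J -> C;
  dmap : forall i j, shom i j -> dob i ~> dob j;
  dmap1 : forall i, dmap (sid i) = idm (dob i);
  dmapM : forall i j k (v : shom j k) (u : shom i j),
    dmap (scomp v u) = dmap v ∘ dmap u
}.

Definition is_cocone J (D : diagram J) X (c : forall j, D j ~> X) :=
  forall i j (u : shom i j), c j ∘ dmap D u = c i.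

Definition is_colimit J (D : diagram J) X (c : forall j, D j ~> X) :=
  is_cocone c /\
  forall Y (c' : forall j, D j ~> Y), is_cocone c' ->
    exists! w : X ~> Y, forall j, w ∘ c j = c' j.

Definition cocomplete := forall J (D : diagram J),
  exists X (c : forall j, D j ~> X), is_colimit c.

Definition is_nattrans J (D E : diagram J) (a : forall j, D j ~> E j) :=
  forall i j (u : shom i j), a j ∘ dmap D u = dmap E u ∘ a i.

Definition exact_filtered_colimits :=
  forall J (D1 D2 D3 : diagram J)
    (a : forall j, D1 j ~> D2 j) (b : forall j, D2 j ~> D3 j)
    X1 X2 X3 (c1 : forall j, D1 j ~> X1) (c2 : forall j, D2 j ~> X2)
    (c3 : forall j, D3 j ~> X3) (u : X1 ~> X2) (v : X2 ~> X3),
  filtered J -> is_nattrans a -> is_nattrans b ->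
  (forall j, short_exact (a j) (b j)) ->
  is_colimit c1 -> is_colimit c2 -> is_colimit c3 ->
  (forall j, u ∘ c1 j = c2 j ∘ a j) -> (forall j, v ∘ c2 j = c3 j ∘ b j) ->
  short_exact u v.

End Colimits.

Section Monoidal.
Variables (K : fieldType) (C : lincat K).

Record monoidal := Monoidal {
  ten : C -> C -> C;
  tenm : forall X X' Y Y', X ~> X' -> Y ~> Y' -> ten X Y ~> ten X' Y';
  tunit : C;
  tenm1 : forall X Y, tenm (idm X) (idm Y) = idm (ten X Y);
  tenmM : forall X X' X'' Y Y' Y'' (f' : X' ~> X'') (f : X ~> X')
    (g' : Y' ~> Y'') (g : Y ~> Y'),
    tenm (f' ∘ f) (g' ∘ g) = tenm f' g' ∘ tenm f g;
  tenm_linearl : forall X X' Y Y' (g : Y ~> Y'),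
    linear (fun f : X ~> X' => tenm f g : ten X Y ~> ten X' Y');
  tenm_linearr : forall X X' Y Y' (f : X ~> X'),
    linear (fun g : Y ~> Y' => tenm f g : ten X Y ~> ten X' Y');
  assoc : forall X Y Z, ten (ten X Y) Z ~> ten X (ten Y Z);
  lunit : forall X, ten tunit X ~> X;
  runit : forall X, ten X tunit ~> X;
  assoc_iso : forall X Y Z, is_iso (assoc X Y Z);
  lunit_iso : forall X, is_iso (lunit X);
  runit_iso : forall X, is_iso (runit X);
  assoc_nat : forall X X' Y Y' Z Z' (f : X ~> X') (g : Y ~> Y') (h : Z ~> Z'),
    assoc X' Y' Z' ∘ tenm (tenm f g) h = tenm f (tenm g h) ∘ assoc X Y Z;
  lunit_nat : forall X X' (f : X ~> X'),
    lunit X' ∘ tenm (idm tunit) f = f ∘ lunit X;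
  runit_nat : forall X X' (f : X ~> X'),
    runit X' ∘ tenm f (idm tunit) = f ∘ runit X;
  pentagon : forall W X Y Z,
    tenm (idm W) (assoc X Y Z) ∘ assoc W (ten X Y) Z
      ∘ tenm (assoc W X Y) (idm Z)
    = assoc W X (ten Y Z) ∘ assoc (ten W X) Y Z;
  triangle : forall X Y,
    tenm (idm X) (lunit Y) ∘ assoc X tunit Y = tenm (runit X) (idm Y)
}.

Variable V : monoidal.

Lemma tenl_map1 J (A : C) (D : diagram C J) i :
  tenm V (idm A) (dmap D (sid i)) = idm (ten V A (D i)).
Proof. by rewrite dmap1 tenm1. Qed.

Lemma tenl_mapM J (A : C) (D : diagram C J) i j k
    (v : shom j k) (u : shom i j) :
  tenm V (idm A) (dmap D (scomp v u))
  = tenm V (idm A) (dmap D v) ∘ tenm V (idm A) (dmap D u).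
Proof. by rewrite dmapM -tenmM comp1m. Qed.

Definition tenl_diagram J (A : C) (D : diagram C J) : diagram C J :=
  Diagram (@tenl_map1 J A D) (@tenl_mapM J A D).

Lemma tenr_map1 J (A : C) (D : diagram C J) i :
  tenm V (dmap D (sid i)) (idm A) = idm (ten V (D i) A).
Proof. by rewrite dmap1 tenm1. Qed.

Lemma tenr_mapM J (A : C) (D : diagram C J) i j k
    (v : shom j k) (u : shom i j) :
  tenm V (dmap D (scomp v u)) (idm A)
  = tenm V (dmap D v) (idm A) ∘ tenm V (dmap D u) (idm A).
Proof. by rewrite dmapM -tenmM comp1m. Qed.

Definition tenr_diagram J (A : C) (D : diagram C J) : diagram C J :=
  Diagram (@tenr_map1 J A D) (@tenr_mapM J A D).

Definition ten_exact := forall (A : C) X Y Z (i : X ~> Y) (p : Y ~> Z),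
  short_exact i p ->
  short_exact (tenm V (idm A) i) (tenm V (idm A) p) /\
  short_exact (tenm V i (idm A)) (tenm V p (idm A)).

Definition ten_filtered_colimits :=
  forall (A : C) J (D : diagram C J) X (c : forall j, D j ~> X),
  filtered J -> is_colimit c ->
  is_colimit (D := tenl_diagram A D) (fun j => tenm V (idm A) (c j)) /\
  is_colimit (D := tenr_diagram A D) (fun j => tenm V (c j) (idm A)).

End Monoidal.

Record basecat (K : fieldType) := BaseCat {
  blin :> lincat K;
  bmon : monoidal blin;
  bcat_abelian : abelian blin;
  bcat_semisimple : semisimple blin;
  bcat_cocomplete : cocomplete blin;
  bcat_exact_filtered : exact_filtered_colimits blin;
  bcat_ten_exact : ten_exact bmon;
  bcat_ten_filtered : ten_filtered_colimits bmon
}.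

Notation "X ⊗ Y" := (ten (bmon _) X Y)
  (at level 35, right associativity) : lincat_scope.
Notation "f ⊠ g" := (tenm (bmon _) f g)
  (at level 35, right associativity) : lincat_scope.

Section LinTheory.
Variables (K : fieldType) (C : lincat K).

Lemma comp0m X Y Z (f : (X : C) ~> Y) : (0 : Y ~> Z) ∘ f = 0.
Proof.
have /= := comp_linearl f (-1) (0 : Y ~> Z) 0.
by rewrite scaler0 addr0 scaleN1r addNr.
Qed.

Lemma compm0 X Y Z (g : (Y : C) ~> Z) : g ∘ (0 : X ~> Y) = 0.
Proof.
have /= := comp_linearr g (-1) (0 : X ~> Y) 0.
by rewrite scaler0 addr0 scaleN1r addNr.
Qed.

Lemma compDl X Y Z (g g' : (Y : C) ~> Z) (f : X ~> Y) :
  (g + g') ∘ f = g ∘ f + g' ∘ f.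
Proof. by have /= := comp_linearl f 1 g g'; rewrite !scale1r. Qed.

Lemma compDr X Y Z (g : (Y : C) ~> Z) (f f' : X ~> Y) :
  g ∘ (f + f') = g ∘ f + g ∘ f'.
Proof. by have /= := comp_linearr g 1 f f'; rewrite !scale1r. Qed.

Lemma compZl X Y Z a (g : (Y : C) ~> Z) (f : X ~> Y) :
  (a *: g) ∘ f = a *: (g ∘ f).
Proof.
by have /= := comp_linearl f a g 0; rewrite comp0m !addr0.
Qed.

Lemma compZr X Y Z a (g : (Y : C) ~> Z) (f : X ~> Y) :
  g ∘ (a *: f) = a *: (g ∘ f).
Proof.
by have /= := comp_linearr g a f 0; rewrite compm0 !addr0.
Qed.

Lemma comp_suml X Y Z I (r : seq I) (P : pred I)
    (g : I -> (Y : C) ~> Z) (f : X ~> Y) :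
  (\sum_(i <- r | P i) g i) ∘ f = \sum_(i <- r | P i) (g i ∘ f).
Proof.
elim/big_rec2: _ => [|i u v _ <-]; first exact: comp0m.
exact: compDl.
Qed.

Lemma comp_sumr X Y Z I (r : seq I) (P : pred I)
    (g : (Y : C) ~> Z) (f : I -> X ~> Y) :
  g ∘ (\sum_(i <- r | P i) f i) = \sum_(i <- r | P i) (g ∘ f i).
Proof.
elim/big_rec2: _ => [|i u v _ <-]; first exact: compm0.
exact: compDr.
Qed.

Variable V : monoidal C.

Lemma ten0m X X' Y Y' (g : (Y : C) ~> Y') : tenm V (0 : X ~> X') g = 0.
Proof.
have /= := tenm_linearl V g (-1) (0 : X ~> X') 0.
by rewrite scaler0 addr0 scaleN1r addNr.
Qed.

Lemma tenm0 X X' Y Y' (f : (X : C) ~> X') : tenm V f (0 : Y ~> Y') = 0.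
Proof.
have /= := tenm_linearr V f (-1) (0 : Y ~> Y') 0.
by rewrite scaler0 addr0 scaleN1r addNr.
Qed.

Lemma tenDl X X' Y Y' (f f' : X ~> X') (g : (Y : C) ~> Y') :
  tenm V (f + f') g = tenm V f g + tenm V f' g.
Proof. by have /= := tenm_linearl V g 1 f f'; rewrite !scale1r. Qed.

Lemma ten_suml X X' Y Y' I (r : seq I) (P : pred I)
    (f : I -> X ~> X') (g : (Y : C) ~> Y') :
  tenm V (\sum_(i <- r | P i) f i) g = \sum_(i <- r | P i) tenm V (f i) g.
Proof.
elim/big_rec2: _ => [|i u v _ <-]; first exact: ten0m.
exact: tenDl.
Qed.

End LinTheory.

Definition discrete (T : Type) : smallcat :=
  @SmallCat T (fun i j => i = j) (fun i => erefl) (fun i j k v u => etrans u v)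
    (fun i j k l h g f => Prop_irrelevance _ _)
    (fun i j f => Prop_irrelevance _ _) (fun i j f => Prop_irrelevance _ _).

Section Coproduct.
Variables (K : fieldType) (V : basecat K).

Section Family.
Variables (T : Type) (A : T -> V).

Definition discr_map (i j : discrete T) (e : shom i j) : A i ~> A j :=
  match e with erefl => idm (A i) end.

Lemma discr_map1 i : discr_map (sid i) = idm (A i).
Proof. by []. Qed.

Lemma discr_mapM (i j k : discrete T) (v : shom j k) (u : shom i j) :
  discr_map (scomp v u) = discr_map v ∘ discr_map u.
Proof. by case: k / v; case: j / u => /=; rewrite comp1m. Qed.

Definition discr_diagram : diagram V (discrete T) := Diagram discr_map1 discr_mapM.

Definition coprod_sig := cid (bcat_cocomplete discr_diagram).
Definition coprod : V := sval coprod_sig.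
Definition coprod_in (t : T) : A t ~> coprod := sval (cid (svalP coprod_sig)) t.

Lemma coprod_colimit : is_colimit (D := discr_diagram) coprod_in.
Proof. exact: svalP (cid (svalP coprod_sig)). Qed.

Lemma coprod_desc_ex Y (u : forall t, A t ~> Y) :
  exists w : coprod ~> Y, forall t, w ∘ coprod_in t = u t.
Proof.
have [_ /(_ Y u)] := coprod_colimit.
case=> [i j e|w [wE _]]; last by exists w.
by case: j / e => /=; rewrite compm1.
Qed.

Definition coprod_desc Y (u : forall t, A t ~> Y) : coprod ~> Y :=
  sval (cid (coprod_desc_ex u)).

Lemma coprod_descE Y (u : forall t, A t ~> Y) t :
  coprod_desc u ∘ coprod_in t = u t.
Proof. exact: svalP (cid (coprod_desc_ex u)) t. Qed.

Lemma coprod_ext Y (w w' : coprod ~> Y) :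
  (forall t, w ∘ coprod_in t = w' ∘ coprod_in t) -> w = w'.
Proof.
move=> ww'; have [_ /(_ Y (fun t => w ∘ coprod_in t))] := coprod_colimit.
case=> [i j e|w0 [_ w0U]]; first by case: j / e => /=; rewrite compm1.
by rewrite -(w0U w) // -(w0U w').
Qed.

End Family.

(* The family of morphisms A i ~> A j that is the identity if i = j and 0
   otherwise. *)
Definition deltam (T : eqType) (A : T -> V) (i j : T) : A i ~> A j :=
  match i =P j with
  | ReflectT e => ecast k (A i ~> A k) e (idm (A i))
  | ReflectF _ => 0
  end.

Lemma deltam_id (T : eqType) (A : T -> V) i : deltam A i i = idm (A i).
Proof.
by rewrite /deltam; case: eqP => // e; rewrite (Prop_irrelevance e (erefl i)).
Qed.

Lemma deltam_neq (T : eqType) (A : T -> V) i j : i != j -> deltam A i j = 0.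
Proof. by rewrite /deltam; case: eqP. Qed.

Section FinitePreservation.
Variables (I : finType) (A : I -> V) (P : V).

Definition coprod_pr (i : I) : coprod A ~> A i := coprod_desc (deltam A ^~ i).

Lemma coprod_id_sum : idm (coprod A) = \sum_i coprod_in A i ∘ coprod_pr i.
Proof.
apply: coprod_ext => t; rewrite comp1m comp_suml (bigD1 t) //= big1 => [|i it].
  by rewrite addr0 -compA coprod_descE deltam_id compm1.
by rewrite -compA coprod_descE deltam_neq ?compm0 // eq_sym.
Qed.

Lemma tenr_fin_ex Y (u : forall i, A i ⊗ P ~> Y) :
  exists w : coprod A ⊗ P ~> Y, forall i, w ∘ (coprod_in A i ⊠ idm P) = u i.
Proof.
exists (\sum_i u i ∘ (coprod_pr i ⊠ idm P)) => t.
rewrite comp_suml (bigD1 t) //= big1 => [|i it].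
  by rewrite addr0 -compA -tenmM coprod_descE deltam_id compm1 tenm1 compm1.
by rewrite -compA -tenmM coprod_descE deltam_neq ?ten0m ?compm0 // eq_sym.
Qed.

Lemma tenr_fin_ext Y (w w' : coprod A ⊗ P ~> Y) :
  (forall i, w ∘ (coprod_in A i ⊠ idm P) = w' ∘ (coprod_in A i ⊠ idm P)) ->
  w = w'.
Proof.
move=> ww'; rewrite -(compm1 w) -(compm1 w') -tenm1 coprod_id_sum ten_suml.
rewrite !comp_sumr; apply: eq_bigr => i _.
by rewrite -(comp1m (idm P)) tenmM !compA ww'.
Qed.

End FinitePreservation.

(* A coproduct is the filtered colimit of its finite subcoproducts. *)
Section Preservation.
Variables (T : choiceType) (A : T -> V) (P : V).

Definition finsub : smallcat :=
  @SmallCat (seq T) (fun s t => {subset s <= t}) (fun s x xs => xs)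
    (fun s t u g f x xs => g x (f x xs))
    (fun _ _ _ _ _ _ _ => Prop_irrelevance _ _)
    (fun _ _ _ => Prop_irrelevance _ _) (fun _ _ _ => Prop_irrelevance _ _).

Lemma finsub_filtered : filtered finsub.
Proof.
split=> [|s t|s t u v]; first by exists; exact: [::].
  have u : shom (s := finsub) s (s ++ t).
    by move=> x xs; rewrite mem_cat xs.
  have v : shom (s := finsub) t (s ++ t).
    by move=> x xt; rewrite mem_cat xt orbT.
  by exists (s ++ t), u, v.
by exists t, (sid t); exact: (@Prop_irrelevance {subset s <= t}).
Qed.

Definition subfam (s : seq T) (x : seq_sub s) : V := A (ssval x).
Definition subcop (s : seq T) : V := coprod (@subfam s).
Definition subcop_in (s : seq T) t (ts : t \in s) : A t ~> subcop s :=
  coprod_in (@subfam s) (SeqSub ts).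

Definition subcop_map (s t : seq T) (st : {subset s <= t}) : subcop s ~> subcop t :=
  coprod_desc (fun x : seq_sub s => subcop_in (st _ (ssvalP x))).

Lemma subcop_mapE (s t : seq T) (st : {subset s <= t}) x (xs : x \in s) :
  subcop_map st ∘ subcop_in xs = subcop_in (st _ xs).
Proof. exact: (coprod_descE _ (SeqSub xs)). Qed.

Lemma subcop_ext (s : seq T) Y (w w' : subcop s ~> Y) :
  (forall x (xs : x \in s), w ∘ subcop_in xs = w' ∘ subcop_in xs) -> w = w'.
Proof. by move=> ww'; apply: coprod_ext => -[x xs]; exact: ww'. Qed.

Lemma subcop_map1 (s : finsub) : subcop_map (sid s) = idm (subcop s).
Proof. by apply: subcop_ext => x xs; rewrite subcop_mapE comp1m. Qed.

Lemma subcop_mapM (s t r : finsub) (v : shom t r) (u : shom s t) :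
  subcop_map (scomp v u) = subcop_map v ∘ subcop_map u.
Proof. by apply: subcop_ext => x xs; rewrite -compA !subcop_mapE. Qed.

Definition subcop_diagram : diagram V finsub := Diagram subcop_map1 subcop_mapM.

Definition subcop_cocone (s : seq T) : subcop s ~> coprod A :=
  coprod_desc (fun x : seq_sub s => coprod_in A (ssval x)).

Lemma subcop_coconeE (s : seq T) x (xs : x \in s) :
  subcop_cocone s ∘ subcop_in xs = coprod_in A x.
Proof. exact: (coprod_descE _ (SeqSub xs)). Qed.

Lemma subcop_colimit : is_colimit (D := subcop_diagram) subcop_cocone.
Proof.
split=> [s t u|Y c cP].
  by apply: subcop_ext => x xs; rewrite -compA subcop_mapE !subcop_coconeE.
pose w := coprod_desc (fun t => c [:: t] ∘ subcop_in (mem_head t [::])).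
exists w; split=> [s|w' w'E].
  apply: subcop_ext => x xs; rewrite -compA subcop_coconeE coprod_descE.
  have u : shom (s := finsub) [:: x] s by move=> y; rewrite inE => /eqP ->.
  by rewrite -(cP _ _ u) -compA subcop_mapE (bool_irrelevance (u _ _) xs).
apply: coprod_ext => t; rewrite coprod_descE -w'E -compA.
by rewrite subcop_coconeE.
Qed.

Lemma tenr_coprod_ex Y (u : forall t, A t ⊗ P ~> Y) :
  exists w : coprod A ⊗ P ~> Y, forall t, w ∘ (coprod_in A t ⊠ idm P) = u t.
Proof.
have [_ [_ /(_ Y)]] := bcat_ten_filtered P finsub_filtered subcop_colimit.
pose v (s : seq T) := cid (tenr_fin_ex (fun x : seq_sub s => u (ssval x))).
have vE (s : seq T) x (xs : x \in s) : sval (v s) ∘ (subcop_in xs ⊠ idm P) = u x.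
  exact: svalP (v s) (SeqSub xs).
case/(_ (fun s => sval (v s))) => [s t st|w [wE _]].
  apply: tenr_fin_ext => -[x xs] /=.
  by rewrite -compA -tenmM comp1m subcop_mapE !vE.
exists w => t; have tt := mem_head t [::].
by rewrite -(vE _ _ tt) -wE -compA -tenmM comp1m subcop_coconeE.
Qed.

Definition tenr_desc Y (u : forall t, A t ⊗ P ~> Y) : coprod A ⊗ P ~> Y :=
  sval (cid (tenr_coprod_ex u)).

Lemma tenr_descE Y (u : forall t, A t ⊗ P ~> Y) t :
  tenr_desc u ∘ (coprod_in A t ⊠ idm P) = u t.
Proof. exact: svalP (cid (tenr_coprod_ex u)) t. Qed.

Lemma tenr_ext Y (w w' : coprod A ⊗ P ~> Y) :
  (forall t, w ∘ (coprod_in A t ⊠ idm P) = w' ∘ (coprod_in A t ⊠ idm P)) ->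
  w = w'.
Proof.
move=> ww'.
have [_ [cP /(_ Y)]] := bcat_ten_filtered P finsub_filtered subcop_colimit.
case/(_ (fun s => w ∘ (subcop_cocone s ⊠ idm P))) => [s t st|w0 [_ w0U]].
  by rewrite -compA; congr (_ ∘ _); exact: cP.
rewrite -(w0U w) // -(w0U w') // => s.
apply: (@tenr_fin_ext _ (@subfam s)) => -[x xs].
by rewrite -!compA -!tenmM comp1m (subcop_coconeE xs) ww'.
Qed.

End Preservation.

End Coproduct.

Arguments coprod_in {K V T} A t.

Section Graded.
Variables (K : fieldType) (V : basecat K).

Definition graded := int -> V.
Implicit Types M N P Q : graded.

(* A morphism of degree p is a matrix of morphisms M i ~> N j in which only the
   entries with j = i + p may be nonzero; no cast between N (i + p + q) and
   N (i + (p + q)) is then needed. *)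
Record ghom (p : int) M N := GHom {
  gmx :> forall i j, M i ~> N j;
  gmxP : forall i j, j != i + p -> gmx i j = 0
}.

Lemma ghom_eqP p M N (f g : ghom p M N) : (forall i j, f i j = g i j) -> f = g.
Proof.
case: f g => [f fP] [g gP] /= fg.
have {}fg : f = g by do 2![apply: functional_extensionality_dep => ?].
by subst g; congr GHom; exact: Prop_irrelevance.
Qed.

Lemma gid_subproof M i j : j != i + 0 -> deltam M i j = 0.
Proof. by rewrite addr0 eq_sym; exact: deltam_neq. Qed.
Definition gid M : ghom 0 M M := GHom (@gid_subproof M).

Lemma gcomp_subproof p q M N P (g : ghom q N P) (f : ghom p M N) i k :
  k != i + (p + q) -> g (i + p) k ∘ f i (i + p) = 0.
Proof. by rewrite addrA => /gmxP ->; exact: comp0m. Qed.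
Definition gcomp p q M N P (g : ghom q N P) (f : ghom p M N) :
  ghom (p + q) M P := GHom (gcomp_subproof g f).

Lemma gadd_subproof p M N (f g : ghom p M N) i j :
  j != i + p -> f i j + g i j = 0.
Proof. by move=> ij; rewrite !gmxP // addr0. Qed.
Definition gadd p M N (f g : ghom p M N) : ghom p M N :=
  GHom (gadd_subproof f g).

Lemma gopp_subproof p M N (f : ghom p M N) i j : j != i + p -> - f i j = 0.
Proof. by move=> ij; rewrite gmxP // oppr0. Qed.
Definition gopp p M N (f : ghom p M N) : ghom p M N := GHom (gopp_subproof f).

Lemma gzero_subproof p M N (i j : int) : j != i + p -> 0 = 0 :> (M i ~> N j).
Proof. by []. Qed.
Definition gzero p M N : ghom p M N := GHom (@gzero_subproof p M N).

Lemma gdiag_subproof M N (f : forall i, M i ~> N i) i j :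
  j != i + 0 -> deltam N i j ∘ f i = 0.
Proof. by move/gid_subproof ->; exact: comp0m. Qed.
Definition gdiag M N (f : forall i, M i ~> N i) : ghom 0 M N :=
  GHom (gdiag_subproof f).

Definition gtenfam M N (n i : int) : V := M i ⊗ N (n - i).
Definition gten M N : graded := fun n => coprod (gtenfam M N n).
Definition gten_in M N n i : M i ⊗ N (n - i) ~> gten M N n :=
  coprod_in (gtenfam M N n) i.

Definition koszul (p q : int) : K := (-1) ^+ absz (p * q).

(* (f ⊗ g)(x ⊗ y) = (-1)^(|g||x|) f(x) ⊗ g(y) *)
Definition gtenm_mx p q M M' N N' (f : ghom p M M') (g : ghom q N N') n m :
    gten M N n ~> gten M' N' m :=
  coprod_desc (fun i => koszul q i *:
    (gten_in M' N' m (i + p)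
       ∘ (f i (i + p) ⊠ g (n - i) (m - (i + p))))).

Lemma gtenm_subproof p q M M' N N' (f : ghom p M M') (g : ghom q N N') n m :
  m != n + (p + q) -> gtenm_mx f g n m = 0.
Proof.
move=> mn; apply: coprod_ext => i; rewrite coprod_descE comp0m.
rewrite [g _ _]gmxP ?tenm0 ?compm0 ?scaler0 //; apply: contraNneq mn => mE.
by rewrite -[m](subrK (i + p)) mE addrACA subrK [q + p]addrC.
Qed.
Definition gtenm p q M M' N N' (f : ghom p M M') (g : ghom q N N') :
  ghom (p + q) (gten M N) (gten M' N') := GHom (gtenm_subproof f g).

(* On (M i ⊗ N (a - i)) ⊗ P (n - a) this is the associator of the base category;
   the deltam factor identifies P (n - a) with P (n - i - (a - i)). *)
Definition gassoc M N P : ghom 0 (gten (gten M N) P) (gten M (gten N P)) :=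
  gdiag (fun n => coprod_desc (A := gtenfam (gten M N) P n) (fun a =>
    tenr_desc (A := gtenfam M N a) (fun i =>
      gten_in M (gten N P) n i
        ∘ (idm (M i) ⊠ (gten_in N P (n - i) (a - i)
             ∘ (idm (N (a - i)) ⊠ deltam P (n - a) (n - i - (a - i)))))
        ∘ assoc (bmon V) (M i) (N (a - i)) (P (n - a))))).

(* tpow M n is the tensor power of M with n + 1 factors *)
Fixpoint tpow M (n : nat) : graded :=
  if n is n'.+1 then gten M (tpow M n') else M.

Fixpoint tpowm M N (f : ghom 0 M N) (n : nat) : ghom 0 (tpow M n) (tpow N n) :=
  if n is n'.+1 then gtenm f (tpowm f n') else f.

End Graded.

Arguments gid {K V} M.
Arguments gzero {K V} p M N.

Notation "g \oG f" := (gcomp g f) (at level 40, left associativity)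
  : lincat_scope.
Notation "f +G g" := (gadd f g) (at level 50, left associativity)
  : lincat_scope.
Notation "M ⊗G N" := (gten M N) (at level 35, right associativity)
  : lincat_scope.
Notation "f ⊠G g" := (gtenm f g) (at level 35, right associativity)
  : lincat_scope.

Section Complexes.
Variables (K : fieldType) (V : basecat K).

Record complex := Complex {
  cgr :> graded V;
  cd : ghom 1 cgr cgr;
  cdd : cd \oG cd = gzero 2 cgr cgr
}.

Definition is_chain_map (X Y : complex) (f : ghom 0 X Y) :=
  cd Y \oG f = f \oG cd X :> ghom 1 X Y.

Definition complex_monic (X Y : complex) (f : ghom 0 X Y) :=
  forall (W : complex) (u v : ghom 0 W X), is_chain_map u -> is_chain_map v ->
    f \oG u = f \oG v -> u = v.

(* H is the cokernel of the morphism b : M (i - 1) ~> Z through which the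
   differential factors, Z being the kernel of d in degree i. *)
Record cohomology (M : graded V) (d : ghom 1 M M) (i : int) := Cohomology {
  coh_Z : V;
  coh_H : V;
  coh_k : coh_Z ~> M i;
  coh_b : M (i - 1) ~> coh_Z;
  coh_q : coh_Z ~> coh_H;
  coh_kP : is_kernel coh_k (d i (i + 1));
  coh_bP : coh_k ∘ coh_b = d (i - 1) i;
  coh_qP : is_cokernel coh_q coh_b
}.

(* The cohomology data are unique up to isomorphism, so that it does not matter
   which ones are used to test whether the induced morphism h is invertible. *)
Definition quasi_iso (M N : graded V) (dM : ghom 1 M M) (dN : ghom 1 N N)
    (f : ghom 0 M N) :=
  forall i, exists (HM : cohomology dM i) (HN : cohomology dN i)
    (z : coh_Z HM ~> coh_Z HN) (h : coh_H HM ~> coh_H HN),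
  [/\ coh_k HN ∘ z = f i i ∘ coh_k HM, h ∘ coh_q HM = coh_q HN ∘ z & is_iso h].

End Complexes.

Section Coalgebras.
Variables (K : fieldType) (V : basecat K).

Record dgcoalg := DGCoalg {
  dgc :> complex V;
  comul : ghom 0 dgc (dgc ⊗G dgc);
  comul_assoc :
    gassoc dgc dgc dgc \oG ((comul ⊠G gid dgc) \oG comul)
    = (gid dgc ⊠G comul) \oG comul :> ghom 0 dgc (dgc ⊗G dgc ⊗G dgc);
  comul_d :
    comul \oG cd dgc = (cd dgc ⊠G gid dgc +G gid dgc ⊠G cd dgc) \oG comul
    :> ghom 1 dgc (dgc ⊗G dgc)
}.

(* The iterated comultiplication with n + 1 factors. *)
Fixpoint itcomul (X : dgcoalg) (n : nat) : ghom 0 X (tpow X n) :=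
  if n is n'.+1 then (gid X ⊠G itcomul X n') \oG comul X else gid X.

Definition is_seq_colimit (X : nat -> V) (t : forall n, X n ~> X n.+1) (Y : V)
    (c : forall n, X n ~> Y) :=
  (forall n, c n.+1 ∘ t n = c n) /\
  forall Z (c' : forall n, X n ~> Z), (forall n, c' n.+1 ∘ t n = c' n) ->
    exists! w : Y ~> Z, forall n, w ∘ c n = c' n.

(* Kernels and colimits of graded objects are computed degreewise. *)
Definition coalg_cocomplete (X : dgcoalg) := forall i : int,
  exists (N : nat -> V) (k : forall n, N n ~> cgr X i)
    (t : forall n, N n ~> N n.+1),
  (forall n, is_kernel (k n) (itcomul X n i i)) /\ is_seq_colimit t k.

Record cogc := Cogc {
  cogc_coalg :> dgcoalg;
  cogc_cocomplete : coalg_cocomplete cogc_coalg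
}.

Record cogc_hom (X Y : cogc) := CogcHom {
  chom :> ghom 0 X Y;
  chom_d : is_chain_map chom;
  chom_comul : comul Y \oG chom = (chom ⊠G chom) \oG comul X
}.

Lemma cogc_hom_eqP (X Y : cogc) (f g : cogc_hom X Y) :
  chom f = chom g -> f = g.
Proof.
case: f g => [f fd fD] [g gd gD] /= fg; subst g.
by congr CogcHom; exact: Prop_irrelevance.
Qed.

End Coalgebras.

Section CogcCategory.
Variables (K : fieldType) (V : basecat K).

Lemma gcompE p q r (M N P Q : graded V) (h : ghom r P Q) (g : ghom q N P)
    (f : ghom p M N) i l :
  (h \oG (g \oG f)) i l = ((h \oG g) \oG f) i l.
Proof. by rewrite /= addrA compA. Qed.

Lemma gcomp0E (M N P : graded V) (g : ghom 0 N P) (f : ghom 0 M N) i j :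
  (g \oG f) i j = g i j ∘ f i i.
Proof. by rewrite /= addr0. Qed.

Lemma gcomp1g p (M N : graded V) (f : ghom p M N) i j :
  (gid N \oG f) i j = f i j.
Proof.
have [->|ij] := eqVneq j (i + p); first by rewrite /= deltam_id comp1m.
by rewrite !gmxP ?addr0.
Qed.

Lemma gcompg1 p (M N : graded V) (f : ghom p M N) i j :
  (f \oG gid M) i j = f i j.
Proof. by rewrite /= addr0 deltam_id compm1. Qed.

Lemma gtenm0E (M M' N N' : graded V) (f : ghom 0 M M') (g : ghom 0 N N')
    n m i :
  (f ⊠G g) n m ∘ gten_in M N n i
  = gten_in M' N' m i ∘ (f i i ⊠ g (n - i) (m - i)).
Proof.
transitivity (koszul K 0 i *: (gten_in M' N' m (i + 0)
  ∘ (f i (i + 0) ⊠ g (n - i) (m - (i + 0))))); first exact: (coprod_descE (A := gtenfam M N n)).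
by rewrite /koszul mul0r expr0 scale1r addr0.
Qed.

Lemma gtenm0M (M M' M'' N N' N'' : graded V) (f' : ghom 0 M' M'')
    (f : ghom 0 M M') (g' : ghom 0 N' N'') (g : ghom 0 N N') :
  (f' \oG f) ⊠G (g' \oG g) = (f' ⊠G g') \oG (f ⊠G g)
  :> ghom 0 (M ⊗G N) (M'' ⊗G N'').
Proof.
apply: ghom_eqP => n m; rewrite gcomp0E; apply: coprod_ext => i.
rewrite -compA [RHS](congr1 _ (gtenm0E _ _ _ _ _)) compA.
rewrite [LHS](gtenm0E (f' \oG f) (g' \oG g)).
by rewrite [in RHS]gtenm0E !gcomp0E tenmM compA.
Qed.

Lemma gtenm11 (M N : graded V) :
  gid M ⊠G gid N = gid (M ⊗G N) :> ghom 0 (M ⊗G N) (M ⊗G N).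
Proof.
apply: ghom_eqP => n m; apply: coprod_ext => i; rewrite [LHS]gtenm0E.
have [->|nm] := eqVneq m n.
  by rewrite /= !deltam_id tenm1 compm1 comp1m.
rewrite [gid (M ⊗G N) _ _]gmxP ?addr0 // comp0m.
rewrite [gid N _ _]gmxP ?tenm0 ?compm0 // addr0.
by apply: contraNneq nm => /addIr ->.
Qed.

Lemma cogc_id_d (X : cogc V) : is_chain_map (gid X).
Proof. by apply: ghom_eqP => i j; rewrite gcomp1g gcompg1. Qed.

Lemma cogc_id_comul (X : cogc V) :
  comul X \oG gid X = (gid X ⊠G gid X) \oG comul X.
Proof. by apply: ghom_eqP => i j; rewrite gtenm11 gcomp1g gcompg1. Qed.

Definition cogc_id (X : cogc V) : cogc_hom X X :=
  CogcHom (@cogc_id_d X) (@cogc_id_comul X).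

Section Comp.
Variables (X Y Z : cogc V) (g : cogc_hom Y Z) (f : cogc_hom X Y).

Lemma cogc_comp_d : @is_chain_map _ _ X Z (g \oG f).
Proof.
apply: ghom_eqP => i j; apply: (etrans (gcompE (cd Z) g f i j)).
apply: (etrans (congr1 (fun u : ghom 1 Y Z => (u \oG f) i j) (chom_d g))).
apply: (etrans (esym (gcompE g (cd Y) f i j))).
apply: (etrans (congr1 (fun u : ghom 1 X Y => (chom g \oG u) i j) (chom_d f))).
exact: (gcompE g f (cd X)).
Qed.

Lemma cogc_comp_comul :
  comul Z \oG (g \oG f) = ((g \oG f) ⊠G (g \oG f)) \oG comul X
  :> ghom 0 X (Z ⊗G Z).
Proof.
apply: ghom_eqP => i j; apply: (etrans (gcompE (comul Z) g f i j)).
apply: (etrans (congr1 (fun u : ghom 0 Y (Z ⊗G Z) => (u \oG f) i j)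
  (chom_comul g))).
apply: (etrans (esym (gcompE (g ⊠G g) (comul Y) f i j))).
apply: (etrans (congr1 (fun u : ghom 0 X (Y ⊗G Y) => ((g ⊠G g) \oG u) i j)
  (chom_comul f))).
apply: (etrans (gcompE (g ⊠G g) (f ⊠G f) (comul X) i j)).
exact: (congr1 (fun u : ghom 0 (X ⊗G X) (Z ⊗G Z) => (u \oG comul X) i j)
  (esym (gtenm0M g f g f))).
Qed.

Definition cogc_comp : cogc_hom X Z := CogcHom cogc_comp_d cogc_comp_comul.

End Comp.

End CogcCategory.

Notation "g ∘C f" := (cogc_comp g f) (at level 40, left associativity)
  : lincat_scope.

Section Cobar.
Variables (K : fieldType) (V : basecat K).

Definition desusp (M : graded V) : graded V := fun i => M (i - 1).

Lemma sus_subproof (M : graded V) (i j : int) :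
  j != i - 1 -> deltam M (i - 1) j = 0.
Proof. by rewrite eq_sym; exact: deltam_neq. Qed.
(* The canonical s : S^-1 M -> S (S^-1 M) = M, with inverse omega. *)
Definition sus (M : graded V) : ghom (-1) (desusp M) M :=
  GHom (sus_subproof M).

Lemma omega_subproof (M : graded V) (i j : int) :
  j != i + 1 -> deltam M i (j - 1) = 0.
Proof. by move=> ij; rewrite deltam_neq // eq_sym subr_eq. Qed.
Definition omega (M : graded V) : ghom 1 M (desusp M) :=
  GHom (omega_subproof M).

Section CobarComplex.
Variable X : cogc V.
Let W := desusp X.

Definition cobar_d1 : ghom 1 W W := gopp (omega X \oG (cd X \oG sus X)).
Definition cobar_d2 : ghom 1 W (W ⊗G W) :=
  gopp ((omega X ⊠G omega X) \oG (comul X \oG sus X)).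

(* The components T^(n+1) W -> T^(n+1) W and T^(n+1) W -> T^(n+2) W of the
   derivation of the tensor algebra extending cobar_d1 + cobar_d2, given by the
   Leibniz rule D (w ⊗ t) = D w ⊗ t + (-1)^|w| w ⊗ D t. *)
Fixpoint cobar_lin (n : nat) : ghom 1 (tpow W n) (tpow W n) :=
  if n is n'.+1 then
    cobar_d1 ⊠G gid (tpow W n') +G (gid W ⊠G cobar_lin n' : ghom 1 _ _)
  else cobar_d1.

Fixpoint cobar_quad (n : nat) : ghom 1 (tpow W n) (tpow W n.+1) :=
  if n is n'.+1 then
    gassoc W W (tpow W n') \oG (cobar_d2 ⊠G gid (tpow W n'))
      +G (gid W ⊠G cobar_quad n' : ghom 1 _ _)
  else cobar_d2.

Definition cobar : graded V := fun i => coprod (fun n => tpow W n i).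
Definition cobar_in (n : nat) (i : int) : tpow W n i ~> cobar i :=
  coprod_in (fun n => tpow W n i) n.

Lemma cobar_d_subproof i j : j != i + 1 ->
  coprod_desc (fun n => cobar_in n j ∘ cobar_lin n i j
    + cobar_in n.+1 j ∘ cobar_quad n i j) = 0.
Proof.
move=> ij; apply: coprod_ext => n; rewrite comp0m.
apply: (etrans (coprod_descE (A := fun n => tpow W n i) _ n)).
by rewrite [cobar_lin _ _ _]gmxP // [cobar_quad _ _ _]gmxP // !compm0 addr0.
Qed.
Definition cobar_d : ghom 1 cobar cobar := GHom cobar_d_subproof.

End CobarComplex.

Section CobarMap.
Variables (X Y : cogc V) (f : cogc_hom X Y).

Lemma desuspm_subproof (i j : int) : j != i + 0 -> f (i - 1) (j - 1) = 0.
Proof.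
by move=> ij; rewrite gmxP //; apply: contraNneq ij; rewrite !addr0 => /addIr ->.
Qed.
Definition desuspm : ghom 0 (desusp X) (desusp Y) := GHom desuspm_subproof.

Lemma cobarm_subproof i j : j != i + 0 ->
  coprod_desc (fun n => cobar_in Y n j ∘ tpowm desuspm n i j) = 0.
Proof.
move=> ij; apply: coprod_ext => n; rewrite comp0m.
apply: (etrans (coprod_descE (A := fun n => tpow (desusp X) n i) _ n)).
by rewrite gmxP // compm0.
Qed.
Definition cobarm : ghom 0 (cobar X) (cobar Y) := GHom cobarm_subproof.

End CobarMap.

End Cobar.

Section Homotopy.
Variables (K : fieldType) (V : basecat K).
Implicit Types X Y Z : cogc V.

Definition weak_equivalence X Y (f : cogc_hom X Y) :=
  quasi_iso (cobar_d X) (cobar_d Y) (cobarm f).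

Definition cofibration X Y (f : cogc_hom X Y) := complex_monic f.

Definition fibration X Y (p : cogc_hom X Y) :=
  forall A B (j : cogc_hom A B) (u : cogc_hom A X) (v : cogc_hom B Y),
    cofibration j -> weak_equivalence j -> p ∘C u = v ∘C j ->
    exists l : cogc_hom B X, l ∘C j = u /\ p ∘C l = v.

Definition cogc_terminal T := forall X, exists! t : cogc_hom X T, True.

Definition fibrant Y :=
  exists T (t : cogc_hom Y T), cogc_terminal T /\ fibration t.

Definition classically_homotopic X Y (f g : cogc_hom X Y) :=
  exists h : ghom (-1) X Y,
    comul Y \oG h = (f ⊠G h +G h ⊠G g) \oG comul X :> ghom (-1) X (Y ⊗G Y) /\
    cd Y \oG h +G h \oG cd X = f +G gopp g :> ghom 0 X Y.

Definition is_cogc_coproduct X Y S (i1 : cogc_hom X S) (i2 : cogc_hom Y S) :=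
  forall Z (u : cogc_hom X Z) (v : cogc_hom Y Z),
    exists! w : cogc_hom S Z, w ∘C i1 = u /\ w ∘C i2 = v.

(* (S, i1, i2) is a coproduct of X with itself, and the equations
   w ∘C i1 = u and w ∘C i2 = v express that w = [u, v]. *)
Record cylinder X := Cylinder {
  cyl_sum : cogc V;
  cyl_in1 : cogc_hom X cyl_sum;
  cyl_in2 : cogc_hom X cyl_sum;
  cyl_sumP : is_cogc_coproduct cyl_in1 cyl_in2;
  cyl_ob : cogc V;
  cyl_i : cogc_hom cyl_sum cyl_ob;
  cyl_p : cogc_hom cyl_ob X;
  cyl_p_weq : weak_equivalence cyl_p;
  cyl_p_i1 : (cyl_p ∘C cyl_i) ∘C cyl_in1 = cogc_id X;
  cyl_p_i2 : (cyl_p ∘C cyl_i) ∘C cyl_in2 = cogc_id X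
}.

Definition left_homotopic X Y (f g : cogc_hom X Y) :=
  exists (I : cylinder X) (H : cogc_hom (cyl_ob I) Y),
    (H ∘C cyl_i I) ∘C cyl_in1 I = f /\ (H ∘C cyl_i I) ∘C cyl_in2 I = g.

End Homotopy.

(* Main.v *)
From HB Require Import structures.
From mathcomp Require Import all_boot all_order all_algebra.
From mathcomp Require Import boolp.
Require Import Defs.

Set Implicit Arguments.
Unset Strict Implicit.
Unset Printing Implicit Defensive.

Import GRing.Theory.
Local Open Scope ring_scope.
Local Open Scope lincat_scope.

(** Both implications rest on one construction.  Let Z and X be cocomplete dg
    coalgebras, p : Z -> X and j : X -> Z morphisms with p j = 1, and let e = j p.
    The glued coalgebra E is obtained from Z by freely adjoining a classical
    homotopy ka from the inclusion io : Z -> E to io e that vanishes on the image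
    of j; as a graded object E is Z plus the suspension of the image of 1 - e.  A
    morphism H on Z extends to E as soon as there is a classical homotopy from H
    to H e that vanishes on the image of e, and every morphism L on E yields the
    homotopy L ka from L io to L io e ([glue_extend], [homotopyT_postcomp]).
    Moreover p extends to q : E -> X, and E retracts onto X through q by a
    classical homotopy ([glue_retract]); hence q is a weak equivalence.

    (a) Take for Z the coproduct of C with itself, for p the folding morphism and
    for j the second inclusion.  Then E is a cylinder for C, and a classical
    homotopy from f to g is exactly what is needed to extend [f, g] to it.

    (b) Let Z be the object of an arbitrary cylinder, H a left homotopy on it and
    j : C -> Z the second end.  From q io = p and the fact that p and q are weak
    equivalences it follows that the inclusion io of Z in E is one, and it is a
    split monomorphism of graded objects.  As C' is fibrant, H extends to L on E.
    The homotopy L ka goes from H to H e, and its restriction to the first end of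
    the cylinder goes from f to g.

    It remains to see that a classical homotopy h from f to g gives a chain
    homotopy between the maps induced on cobar constructions: on a tensor power
    it is the sum of the f ⊗ .. ⊗ f ⊗ h ⊗ g ⊗ .. ⊗ g, up to desuspension
    ([cobarm_homotopy]).  Weak equivalences are then handled by elementary
    cohomology.  The glued coalgebra is cocomplete because its iterated
    comultiplications, restricted along io or ka, factor through those of Z
    ([itcomul_hom], [itcomul_coderivation]); with exactness of filtered colimits
    it suffices that the kernels of the iterated comultiplications be jointly
    epic ([union_seq_colimit], [epic_cocomplete]).

    All identities are verified in the base category: a graded object M is
    replaced by the coproduct [tot M] of its components and a graded morphism by
    the induced morphism [totm f].  This is faithful, it forgets the degrees, and
    the Koszul signs become composition with an involution [tsgn M]. *)

(** * Linear monoidal categories *)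

Ltac move_last y :=
  repeat match goal with
  | |- context [(?a + y + ?z)%R] =>
      tryif constr_eq y z then fail else rewrite (addrAC a y z)
  end.

Ltac move_first y :=
  try match goal with
  | |- context [(y + ?z)%R] =>
      tryif constr_eq y z then fail else rewrite (addrC y z)
  end; move_last y.

Ltac cancel_last :=
  match goal with
  | |- (?x - ?x = 0)%R => exact: subrr
  | |- (- ?x + ?x = 0)%R => exact: addNr
  | |- (_ - ?x = 0)%R => move_first x; rewrite subrK
  | |- (_ + ?x = 0)%R =>
      match goal with
      | |- context [@GRing.opp ?T x] => move_first (@GRing.opp T x); rewrite addrK
      end
  end.

(** Closes identities between signed sums whose terms cancel in pairs; the terms
    are compared syntactically. *)
Ltac zmod_cancel :=
  apply/eqP; rewrite -subr_eq0 ?opprD ?opprK ?subr0 ?sub0r; apply/eqP;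
  rewrite ?addrA ?opprD ?opprK ?addrA; repeat cancel_last; rewrite ?subrr ?addNr.

Section LinMore.
Variables (K : fieldType) (C : lincat K).

Lemma compNl (X Y Z : C) (g : Y ~> Z) (f : X ~> Y) : (- g) ∘ f = - (g ∘ f).
Proof. by rewrite -!scaleN1r compZl. Qed.

Lemma compNr (X Y Z : C) (g : Y ~> Z) (f : X ~> Y) : g ∘ (- f) = - (g ∘ f).
Proof. by rewrite -!scaleN1r compZr. Qed.

Variable T : monoidal C.

Lemma tenDr (X X' Y Y' : C) (f : X ~> X') (g g' : Y ~> Y') :
  tenm T f (g + g') = tenm T f g + tenm T f g'.
Proof. by have /= := tenm_linearr T f 1 g g'; rewrite !scale1r. Qed.

Lemma tenZl (X X' Y Y' : C) a (f : X ~> X') (g : Y ~> Y') :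
  tenm T (a *: f) g = a *: tenm T f g.
Proof. by have /= := tenm_linearl T g a f 0; rewrite ten0m !addr0. Qed.

Lemma tenZr (X X' Y Y' : C) a (f : X ~> X') (g : Y ~> Y') :
  tenm T f (a *: g) = a *: tenm T f g.
Proof. by have /= := tenm_linearr T f a g 0; rewrite tenm0 !addr0. Qed.

Lemma tenNl (X X' Y Y' : C) (f : X ~> X') (g : Y ~> Y') :
  tenm T (- f) g = - tenm T f g.
Proof. by rewrite -!scaleN1r tenZl. Qed.

Lemma tenNr (X X' Y Y' : C) (f : X ~> X') (g : Y ~> Y') :
  tenm T f (- g) = - tenm T f g.
Proof. by rewrite -!scaleN1r tenZr. Qed.

Lemma ten_sumr (X X' Y Y' : C) I (r : seq I) (P : pred I)
    (f : X ~> X') (g : I -> Y ~> Y') :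
  tenm T f (\sum_(i <- r | P i) g i) = \sum_(i <- r | P i) tenm T f (g i).
Proof.
elim/big_rec2: _ => [|i u v _ <-]; first exact: tenm0.
exact: tenDr.
Qed.

(** The interchange law in the middle of a composite associated to the right. *)
Lemma tenA (X X' X'' Y Y' Y'' W : C) (f' : X' ~> X'') (f : X ~> X')
    (g' : Y' ~> Y'') (g : Y ~> Y') (u : W ~> ten T X Y) :
  tenm T f' g' ∘ (tenm T f g ∘ u) = tenm T (f' ∘ f) (g' ∘ g) ∘ u.
Proof. by rewrite compA -tenmM. Qed.

Lemma ten_compl (X X' X'' Y Y' : C) (f' : X' ~> X'') (f : X ~> X') (g : Y ~> Y') :
  tenm T (f' ∘ f) g = tenm T f' g ∘ tenm T f (idm Y).
Proof. by rewrite -tenmM compm1. Qed.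

Lemma ten_compr (X X' Y Y' Y'' : C) (f : X ~> X') (g' : Y' ~> Y'') (g : Y ~> Y') :
  tenm T f (g' ∘ g) = tenm T f g' ∘ tenm T (idm X) g.
Proof. by rewrite -tenmM compm1. Qed.

End LinMore.

(** * Tensoring on the left with a coproduct *)

Section LeftPreservation.
Variables (K : fieldType) (V : basecat K) (T : choiceType) (A : T -> V) (P : V).

Lemma tenl_fin_ex (I : finType) (B : I -> V) Y (u : forall i, P ⊗ B i ~> Y) :
  exists w : P ⊗ coprod B ~> Y, forall i, w ∘ (idm P ⊠ coprod_in B i) = u i.
Proof.
exists (\sum_i u i ∘ (idm P ⊠ coprod_pr B i)) => t.
rewrite comp_suml (bigD1 t) //= big1 => [|i it].
  by rewrite addr0 -compA -tenmM coprod_descE deltam_id compm1 tenm1 compm1.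
by rewrite -compA -tenmM coprod_descE deltam_neq ?tenm0 ?compm0 // eq_sym.
Qed.

Lemma tenl_fin_ext (I : finType) (B : I -> V) Y (w w' : P ⊗ coprod B ~> Y) :
  (forall i, w ∘ (idm P ⊠ coprod_in B i) = w' ∘ (idm P ⊠ coprod_in B i)) ->
  w = w'.
Proof.
move=> ww'; rewrite -(compm1 w) -(compm1 w') -tenm1 coprod_id_sum ten_sumr.
rewrite !comp_sumr; apply: eq_bigr => i _.
by rewrite -(comp1m (idm P)) tenmM !compA ww'.
Qed.

(** For a finite coproduct this is additivity of the tensor product.  In general
    a coproduct is the filtered colimit of its finite subcoproducts, and tensoring
    preserves filtered colimits. *)
Lemma tenl_coprod_ex Y (u : forall t, P ⊗ A t ~> Y) :
  exists w : P ⊗ coprod A ~> Y, forall t, w ∘ (idm P ⊠ coprod_in A t) = u t.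
Proof.
have [[_ /(_ Y) colP] _] :=
  bcat_ten_filtered P (finsub_filtered T) (subcop_colimit A).
pose v (s : seq T) := cid (tenl_fin_ex (fun x : seq_sub s => u (ssval x))).
have vE (s : seq T) x (xs : x \in s) :
    sval (v s) ∘ (idm P ⊠ subcop_in A xs) = u x.
  exact: svalP (v s) (SeqSub xs).
case/(_ (fun s => sval (v s))): colP => [s t st|w [wE _]].
  apply: tenl_fin_ext => -[x xs] /=.
  by rewrite -compA -tenmM comp1m (subcop_mapE A st xs) !vE.
exists w => t; have tt := mem_head t [::].
by rewrite -(vE _ _ tt) -wE -compA -tenmM comp1m subcop_coconeE.
Qed.

Definition tenl_desc Y (u : forall t, P ⊗ A t ~> Y) : P ⊗ coprod A ~> Y :=
  sval (cid (tenl_coprod_ex u)).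

Lemma tenl_descE Y (u : forall t, P ⊗ A t ~> Y) t :
  tenl_desc u ∘ (idm P ⊠ coprod_in A t) = u t.
Proof. exact: svalP (cid (tenl_coprod_ex u)) t. Qed.

End LeftPreservation.

(** * The total object of a graded object *)

Section Tot.
Variables (K : fieldType) (V : basecat K).
Implicit Types M N P Q : graded V.

(** Composites of morphisms between total objects carry no degrees, so that they
    can be rewritten without casts between M (i + p + q) and M (i + (p + q)). *)
Definition tot M : V := coprod M.
Definition tin M i : M i ~> tot M := coprod_in M i.

Lemma tot_ext M (Y : V) (f g : tot M ~> Y) :
  (forall i, f ∘ tin M i = g ∘ tin M i) -> f = g.
Proof. exact: coprod_ext. Qed.

Lemma tin_mono M i (Y : V) (f g : Y ~> M i) :
  tin M i ∘ f = tin M i ∘ g -> f = g.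
Proof.
move=> /(congr1 (fun u => coprod_desc (fun k => deltam M k i) ∘ u)).
by rewrite !compA coprod_descE deltam_id !comp1m.
Qed.

Lemma tin_deltam M i j : j = i -> tin M j ∘ deltam M i j = tin M i.
Proof. by move=> ->; rewrite deltam_id compm1. Qed.

Definition totm p M N (f : ghom p M N) : tot M ~> tot N :=
  coprod_desc (fun i => tin N (i + p) ∘ f i (i + p)).

Lemma totmE p M N (f : ghom p M N) i j :
  j = i + p -> totm f ∘ tin M i = tin N j ∘ f i j.
Proof. by move=> ->; apply: coprod_descE. Qed.

(** Passing to total objects is faithful, so that identities between graded
    morphisms may be checked in the base category, where no degrees appear. *)
Lemma totm_inj p M N (f g : ghom p M N) : totm f = totm g -> f = g.
Proof.
move=> fg; apply: ghom_eqP => i j; have [->|ij] := eqVneq j (i + p); last first.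
  by rewrite !gmxP.
by apply: (@tin_mono N); rewrite -!(totmE _ erefl) fg.
Qed.

Lemma totm_comp p q M N P (g : ghom q N P) (f : ghom p M N) :
  totm (g \oG f) = totm g ∘ totm f.
Proof.
apply: tot_ext => i; rewrite (totmE _ (j := i + (p + q))) //= -compA.
by rewrite (totmE f (j := i + p)) // [RHS]compA (totmE g (j := i + (p + q)))
  ?addrA // compA.
Qed.

Lemma totm_add p M N (f g : ghom p M N) : totm (f +G g) = totm f + totm g.
Proof. by apply: tot_ext => i; rewrite compDl !(totmE _ erefl) /= compDr. Qed.

Lemma totm_opp p M N (f : ghom p M N) : totm (gopp f) = - totm f.
Proof. by apply: tot_ext => i; rewrite compNl !(totmE _ erefl) /= compNr. Qed.

Lemma totm_zero p M N : totm (gzero p M N) = 0.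
Proof. by apply: tot_ext => i; rewrite comp0m (totmE _ erefl) /= compm0. Qed.

Lemma totm_id M : totm (gid M) = idm (tot M).
Proof. by apply: tot_ext => i; rewrite comp1m (totmE _ erefl) /= tin_deltam
  ?addr0. Qed.

Lemma totm_diag M N (f : forall i, M i ~> N i) i :
  totm (gdiag f) ∘ tin M i = tin N i ∘ f i.
Proof. by rewrite (totmE _ (j := i)) ?addr0 //= deltam_id comp1m. Qed.


Lemma koszulE (q i : int) : koszul K q i = (-1) ^ (q * i).
Proof.
by rewrite /koszul; case: (q * i) => n //=; rewrite /exprz invr_sign.
Qed.

Lemma koszulD (q i j : int) : koszul K q (i + j) = koszul K q i * koszul K q j.
Proof. by rewrite !koszulE mulrDr expfzDr // oppr_eq0 oner_neq0. Qed.

(** The sign (-1)^(q i) in degree i: the Koszul sign that a morphism of degree q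
    picks up when it passes an element of degree i. *)
Definition twist (q : int) M : tot M ~> tot M :=
  coprod_desc (fun i => koszul K q i *: tin M i).

Lemma twistE q M i : twist q M ∘ tin M i = koszul K q i *: tin M i.
Proof. exact: coprod_descE. Qed.

Definition tsgn M := twist 1 M.

Lemma twist0 M : twist 0 M = idm (tot M).
Proof. by apply: tot_ext => i; rewrite twistE /koszul mul0r expr0 scale1r
  comp1m. Qed.

Lemma twistN1 M : twist (-1) M = tsgn M.
Proof. by apply: tot_ext => i; rewrite !twistE /koszul !mulNr abszN. Qed.

Lemma tsgnK M : tsgn M ∘ tsgn M = idm (tot M).
Proof.
apply: tot_ext => i; rewrite -compA !twistE compZr twistE scalerA comp1m.
by rewrite /koszul -exprD addnn -signr_odd odd_double expr0 scale1r.
Qed.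

Lemma tsgn_totm p M N (f : ghom p M N) :
  tsgn N ∘ totm f = koszul K 1 p *: (totm f ∘ tsgn M).
Proof.
apply: tot_ext => i; rewrite compZl -!compA twistE compZr (totmE _ erefl).
by rewrite compA twistE compZl koszulD scalerA mulrC.
Qed.

Lemma tsgn_totm0 M N (f : ghom 0 M N) : tsgn N ∘ totm f = totm f ∘ tsgn M.
Proof. by rewrite tsgn_totm scale1r. Qed.

Lemma tsgn_totm1 M N (f : ghom 1 M N) : tsgn N ∘ totm f = - (totm f ∘ tsgn M).
Proof. by rewrite tsgn_totm /koszul expr1 scaleN1r. Qed.

Lemma tsgn_totmN1 M N (f : ghom (-1) M N) :
  tsgn N ∘ totm f = - (totm f ∘ tsgn M).
Proof. by rewrite tsgn_totm /koszul expr1 scaleN1r. Qed.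

(** * The total object of a tensor product *)

(** The comparison of the total object of a tensor product with the tensor
    product of the total objects. *)
Definition nu M N : tot (M ⊗G N) ~> tot M ⊗ tot N :=
  coprod_desc (fun n => coprod_desc (A := gtenfam M N n) (fun i =>
    tin M i ⊠ tin N (n - i))).

Lemma nuE M N n i :
  nu M N ∘ (tin (M ⊗G N) n ∘ gten_in M N n i) = tin M i ⊠ tin N (n - i).
Proof.
rewrite compA; apply: (etrans (congr1 (fun u => u ∘ _) (coprod_descE _ n))).
exact: (coprod_descE (A := gtenfam M N n)).
Qed.

Lemma totten_ext M N (Y : V) (f g : tot (M ⊗G N) ~> Y) :
  (forall n i, f ∘ (tin (M ⊗G N) n ∘ gten_in M N n i)
    = g ∘ (tin (M ⊗G N) n ∘ gten_in M N n i)) -> f = g.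
Proof.
move=> fg; apply: tot_ext => n; apply: (coprod_ext (A := gtenfam M N n)) => i.
by have := fg n i; rewrite !compA.
Qed.

(** The retraction is defined componentwise, since the tensor product of the
    base category preserves coproducts in both variables. *)
Lemma nu_split M N : exists mu, mu ∘ nu M N = idm (tot (M ⊗G N)).
Proof.
exists (tenr_desc (A := M) (fun i => tenl_desc (A := N) (fun j =>
    tin (M ⊗G N) (i + j) ∘ (gten_in M N (i + j) i
      ∘ (idm (M i) ⊠ deltam N j (i + j - i)))))).
apply: totten_ext => n i; rewrite -compA nuE comp1m.
rewrite -[tin M i]compm1 -[tin N _]comp1m tenmM compA tenr_descE tenl_descE.
have inE m : m = n ->
    tin (M ⊗G N) m ∘ (gten_in M N m i ∘ (idm (M i) ⊠ deltam N (n - i) (m - i)))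
    = tin (M ⊗G N) n ∘ gten_in M N n i.
  by move=> ->; rewrite deltam_id tenm1 compm1.
by rewrite inE // addrC subrK.
Qed.

(** This makes it possible to check identities between graded morphisms into a
    tensor product after composition with [nu]. *)
Lemma nu_mono M N (Y : V) (f g : Y ~> tot (M ⊗G N)) :
  nu M N ∘ f = nu M N ∘ g -> f = g.
Proof.
have [mu muK] := nu_split M N.
by move=> /(congr1 (fun u => mu ∘ u)); rewrite !compA muK !comp1m.
Qed.

Lemma ten_nu_mono M N (W Y : V) (f g : Y ~> W ⊗ tot (M ⊗G N)) :
  (idm W ⊠ nu M N) ∘ f = (idm W ⊠ nu M N) ∘ g -> f = g.
Proof.
have [mu muK] := nu_split M N.
move=> /(congr1 (fun u => (idm W ⊠ mu) ∘ u)).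
by rewrite !tenA comp1m muK tenm1 !comp1m.
Qed.

Lemma gtenmE p q M M' N N' (f : ghom p M M') (g : ghom q N N') n m i :
  (f ⊠G g) n m ∘ gten_in M N n i
  = koszul K q i *: (gten_in M' N' m (i + p)
      ∘ (f i (i + p) ⊠ g (n - i) (m - (i + p)))).
Proof. exact: (coprod_descE (A := gtenfam M N n)). Qed.

(** Under the comparison the Koszul sign of a tensor product of graded morphisms
    becomes a twist of the first factor. *)
Lemma nu_gtenm p q M M' N N' (f : ghom p M M') (g : ghom q N N') :
  nu M' N' ∘ totm (f ⊠G g) = ((totm f ∘ twist q M) ⊠ totm g) ∘ nu M N.
Proof.
apply: totten_ext => n i; rewrite -!compA nuE -tenmM -compA twistE compZr.
rewrite (compA (totm _)) (totmE _ erefl) -compA gtenmE !compZr tenZl; congr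
  (_ *: _).
rewrite (compA (tin _ _)) compA nuE -tenmM; congr (_ ⊠ _).
  by rewrite (totmE _ erefl).
rewrite (totmE g (j := n + (p + q) - (i + p))) //.
by rewrite opprD addrACA [p + q]addrC addrK.
Qed.

End Tot.

Section TotTensor.
Variables (K : fieldType) (V : basecat K).
Implicit Types M N P : graded V.

Lemma nu_gtenm00 M M' N N' (f : ghom 0 M M') (g : ghom 0 N N') :
  nu M' N' ∘ totm (f ⊠G g) = (totm f ⊠ totm g) ∘ nu M N.
Proof. by rewrite nu_gtenm twist0 compm1. Qed.

Lemma nu_gtenm10 M M' N N' (f : ghom 1 M M') (g : ghom 0 N N') :
  nu M' N' ∘ totm (f ⊠G g) = (totm f ⊠ totm g) ∘ nu M N.
Proof. by rewrite nu_gtenm twist0 compm1. Qed.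

Lemma nu_gtenmN10 M M' N N' (f : ghom (-1) M M') (g : ghom 0 N N') :
  nu M' N' ∘ totm (f ⊠G g) = (totm f ⊠ totm g) ∘ nu M N.
Proof. by rewrite nu_gtenm twist0 compm1. Qed.

Lemma nu_gtenm01 M M' N N' (f : ghom 0 M M') (g : ghom 1 N N') :
  nu M' N' ∘ totm (f ⊠G g) = ((totm f ∘ tsgn M) ⊠ totm g) ∘ nu M N.
Proof. by rewrite nu_gtenm. Qed.

Lemma nu_gtenm11 M M' N N' (f : ghom 1 M M') (g : ghom 1 N N') :
  nu M' N' ∘ totm (f ⊠G g) = ((totm f ∘ tsgn M) ⊠ totm g) ∘ nu M N.
Proof. by rewrite nu_gtenm. Qed.

Lemma nu_gtenm0N1 M M' N N' (f : ghom 0 M M') (g : ghom (-1) N N') :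
  nu M' N' ∘ totm (f ⊠G g) = ((totm f ∘ tsgn M) ⊠ totm g) ∘ nu M N.
Proof. by rewrite nu_gtenm twistN1. Qed.

(** The total degree of a component is the sum of the two degrees, and signs are
    multiplicative in the degree. *)
Lemma nu_tsgn M N : nu M N ∘ tsgn (M ⊗G N) = (tsgn M ⊠ tsgn N) ∘ nu M N.
Proof.
apply: totten_ext => n i; rewrite -!compA (compA (tsgn (M ⊗G N))) twistE compZl
  compZr.
rewrite !nuE -tenmM !twistE tenZl tenZr scalerA -koszulD; congr
  (koszul K 1 _ *: _).
by rewrite addrC subrK.
Qed.

Lemma nu_assoc M N P :
  (idm (tot M) ⊠ nu N P) ∘ (nu M (N ⊗G P) ∘ totm (gassoc M N P))
  = assoc (bmon V) (tot M) (tot N) (tot P)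
    ∘ ((nu M N ⊠ idm (tot P)) ∘ nu (M ⊗G N) P).
Proof.
apply: totten_ext => n a.
rewrite -!compA nuE (compA (totm _)) totm_diag -compA.
rewrite (coprod_descE (A := gtenfam (M ⊗G N) P n)).
apply: (tenr_ext (A := gtenfam M N a)) => i.
rewrite -!compA tenr_descE -!compA.
rewrite (compA (tin _ _)) (compA (nu _ _)) nuE !tenA.
rewrite comp1m compm1 -tenmM comp1m compm1.
rewrite -!compA [nu M N ∘ _](nuE M N a i) (assoc_nat (bmon V)).
rewrite (compA (tin _ _) (gten_in _ _ _ _)) (compA (nu _ _)) nuE -tenmM compm1.
by rewrite tin_deltam // opprB addrA subrK.
Qed.


End TotTensor.

(** * Coalgebras and homotopies in terms of total objects *)

(** Locked, for otherwise rewriting with associativity of composition sees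
    through the comultiplication to the composite that defines it. *)
HB.lock Definition tcomul (K : fieldType) (V : basecat K) (M N P : graded V)
    (D : ghom 0 M (N ⊗G P)) : tot M ~> tot N ⊗ tot P :=
  nu N P ∘ totm D.
Arguments tcomul {K V M N P} D.

Lemma tcomulE (K : fieldType) (V : basecat K) (M N P : graded V)
    (D : ghom 0 M (N ⊗G P)) : tcomul D = nu N P ∘ totm D.
Proof. by rewrite tcomul.unlock. Qed.

Section TotCoalgebra.
Variables (K : fieldType) (V : basecat K).
Implicit Types M N P : graded V.

Lemma coassocE M (D : ghom 0 M (M ⊗G M)) :
  gassoc M M M \oG ((D ⊠G gid M) \oG D) = (gid M ⊠G D) \oG D
    :> ghom 0 M (M ⊗G M ⊗G M)
  <-> assoc (bmon V) (tot M) (tot M) (tot M)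
        ∘ ((tcomul D ⊠ idm (tot M)) ∘ tcomul D)
      = (idm (tot M) ⊠ tcomul D) ∘ tcomul D.
Proof.
have lE : (idm _ ⊠ nu M M)
      ∘ (nu M (M ⊗G M) ∘ totm (gassoc M M M \oG ((D ⊠G gid M) \oG D)))
    = assoc (bmon V) (tot M) (tot M) (tot M)
        ∘ ((tcomul D ⊠ idm (tot M)) ∘ tcomul D).
  rewrite !tcomulE !totm_comp (compA (nu _ _)) compA nu_assoc -!compA.
  by rewrite (compA (nu _ _)) nu_gtenm00 -!compA tenA totm_id comp1m.
have rE : (idm _ ⊠ nu M M) ∘ (nu M (M ⊗G M) ∘ totm ((gid M ⊠G D) \oG D))
    = (idm (tot M) ⊠ tcomul D) ∘ tcomul D.
  by rewrite !tcomulE totm_comp (compA (nu _ _)) nu_gtenm00 -!compA tenA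
    totm_id comp1m.
split=> [e|e]; first by rewrite -lE -rE e.
by apply: totm_inj; apply: nu_mono; apply: ten_nu_mono; rewrite lE e -rE.
Qed.

Lemma comul_dE M (D : ghom 0 M (M ⊗G M)) (d : ghom 1 M M) :
  D \oG d = (d ⊠G gid M +G gid M ⊠G d) \oG D :> ghom 1 M (M ⊗G M)
  <-> tcomul D ∘ totm d
      = (totm d ⊠ idm (tot M) + tsgn M ⊠ totm d) ∘ tcomul D.
Proof.
have lE : nu M M ∘ totm (D \oG d) = tcomul D ∘ totm d.
  by rewrite !tcomulE totm_comp compA.
have rE : nu M M ∘ totm ((d ⊠G gid M +G gid M ⊠G d) \oG D)
    = (totm d ⊠ idm (tot M) + tsgn M ⊠ totm d) ∘ tcomul D.
  rewrite !tcomulE totm_comp totm_add compA compDr nu_gtenm10 nu_gtenm01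
    totm_id comp1m.
  by rewrite -compDl -compA.
split=> [e|e]; first by rewrite -lE -rE e.
by apply: totm_inj; apply: nu_mono; rewrite lE e -rE.
Qed.

Lemma comultE M N (D : ghom 0 M (M ⊗G M)) (D' : ghom 0 N (N ⊗G N))
    (f : ghom 0 M N) :
  D' \oG f = (f ⊠G f) \oG D :> ghom 0 M (N ⊗G N)
  <-> tcomul D' ∘ totm f = (totm f ⊠ totm f) ∘ tcomul D.
Proof.
have lE : nu N N ∘ totm (D' \oG f) = tcomul D' ∘ totm f.
  by rewrite !tcomulE totm_comp compA.
have rE : nu N N ∘ totm ((f ⊠G f) \oG D) = (totm f ⊠ totm f) ∘ tcomul D.
  by rewrite !tcomulE totm_comp compA nu_gtenm00 -compA.
split=> [e|e]; first by rewrite -lE -rE e.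
by apply: totm_inj; apply: nu_mono; rewrite lE e -rE.
Qed.

Lemma coderivationE M N (D : ghom 0 M (M ⊗G M)) (D' : ghom 0 N (N ⊗G N))
    (f g : ghom 0 M N) (h : ghom (-1) M N) :
  D' \oG h = (f ⊠G h +G h ⊠G g) \oG D :> ghom (-1) M (N ⊗G N)
  <-> tcomul D' ∘ totm h
      = ((totm f ∘ tsgn M) ⊠ totm h + totm h ⊠ totm g) ∘ tcomul D.
Proof.
have lE : nu N N ∘ totm (D' \oG h) = tcomul D' ∘ totm h.
  by rewrite !tcomulE totm_comp compA.
have rE : nu N N ∘ totm ((f ⊠G h +G h ⊠G g) \oG D)
    = ((totm f ∘ tsgn M) ⊠ totm h + totm h ⊠ totm g) ∘ tcomul D.
  rewrite !tcomulE totm_comp totm_add compA compDr nu_gtenm0N1 nu_gtenmN10.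
  by rewrite -compDl -compA.
split=> [e|e]; first by rewrite -lE -rE e.
by apply: totm_inj; apply: nu_mono; rewrite lE e -rE.
Qed.

Lemma homotopyE M N (d : ghom 1 M M) (d' : ghom 1 N N)
    (f g : ghom 0 M N) (h : ghom (-1) M N) :
  d' \oG h +G h \oG d = f +G gopp g :> ghom 0 M N
  <-> totm d' ∘ totm h + totm h ∘ totm d = totm f - totm g.
Proof.
have lE : totm (d' \oG h +G h \oG d : ghom 0 M N)
    = totm d' ∘ totm h + totm h ∘ totm d.
  by rewrite (totm_add (p := 0)) -!totm_comp.
have rE : totm (f +G gopp g) = totm f - totm g.
  by rewrite totm_add totm_opp.
split=> [e|e]; first by rewrite -lE -rE e.
by apply: totm_inj; rewrite lE e -rE.
Qed.

Lemma chain_mapE M N (d : ghom 1 M M) (d' : ghom 1 N N) (f : ghom 0 M N) :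
  d' \oG f = f \oG d :> ghom 1 M N <-> totm d' ∘ totm f = totm f ∘ totm d.
Proof.
split=> [e|e]; first by rewrite -!totm_comp e.
by apply: totm_inj; rewrite (totm_comp d' f) e -(totm_comp f d).
Qed.

Lemma differentialE M (d : ghom 1 M M) :
  d \oG d = gzero 2 M M <-> totm d ∘ totm d = 0.
Proof.
split=> [e|e]; first by rewrite -totm_comp e totm_zero.
by apply: totm_inj; rewrite (totm_comp d d) e totm_zero.
Qed.

End TotCoalgebra.

(** * Laws of dg coalgebras in terms of total objects *)

Section Laws.
Variables (K : fieldType) (V : basecat K).

Lemma tcomul_assoc (X : dgcoalg V) :
  assoc (bmon V) (tot X) (tot X) (tot X)
    ∘ ((tcomul (comul X) ⊠ idm (tot X)) ∘ tcomul (comul X))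
  = (idm (tot X) ⊠ tcomul (comul X)) ∘ tcomul (comul X).
Proof. by apply/coassocE; apply: comul_assoc. Qed.

Lemma tcomul_d (X : dgcoalg V) :
  tcomul (comul X) ∘ totm (cd X)
  = (totm (cd X) ⊠ idm (tot X) + tsgn X ⊠ totm (cd X)) ∘ tcomul (comul X).
Proof. by apply/comul_dE; apply: comul_d. Qed.

Lemma totm_dd (X : complex V) : totm (cd X) ∘ totm (cd X) = 0.
Proof. by apply/differentialE; apply: cdd. Qed.

Lemma chom_totd (X Y : cogc V) (f : cogc_hom X Y) :
  totm (cd Y) ∘ totm f = totm f ∘ totm (cd X).
Proof. by apply/chain_mapE; apply: chom_d. Qed.

Lemma chom_tcomul (X Y : cogc V) (f : cogc_hom X Y) :
  tcomul (comul Y) ∘ totm f = (totm f ⊠ totm f) ∘ tcomul (comul X).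
Proof. by apply/comultE; apply: chom_comul. Qed.

Lemma cogc_hom_inj (X Y : cogc V) (f g : cogc_hom X Y) : totm f = totm g -> f = g.
Proof. by move=> /totm_inj; apply: cogc_hom_eqP. Qed.

Lemma totm_cogc_comp (X Y Z : cogc V) (g : cogc_hom Y Z) (f : cogc_hom X Y) :
  totm (g ∘C f) = totm g ∘ totm f.
Proof. exact: (totm_comp (chom g) (chom f)). Qed.

Lemma totm_cogc_id (X : cogc V) : totm (cogc_id X) = idm (tot X).
Proof. exact: totm_id. Qed.

Lemma tsgn_tcomul (M N P : graded V) (D : ghom 0 M (N ⊗G P)) :
  (tsgn N ⊠ tsgn P) ∘ tcomul D = tcomul D ∘ tsgn M.
Proof. by rewrite tcomulE -compA -(tsgn_totm0 D) !compA nu_tsgn. Qed.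

(** A direct sum inherits the laws of a dg coalgebra from summands which are
    themselves dg coalgebras. *)
Section Transport.
Variables (X : dgcoalg V) (E : graded V) (d : ghom 1 E E)
  (D : ghom 0 E (E ⊗G E)) (f : ghom 0 X E).
Hypotheses (fd : totm d ∘ totm f = totm f ∘ totm (cd X))
  (fD : tcomul D ∘ totm f = (totm f ⊠ totm f) ∘ tcomul (comul X)).

Lemma dd_image : (totm d ∘ totm d) ∘ totm f = 0.
Proof. by rewrite -compA fd compA fd -compA totm_dd compm0. Qed.

Lemma comul_d_image :
  (tcomul D ∘ totm d) ∘ totm f
  = ((totm d ⊠ idm (tot E) + tsgn E ⊠ totm d) ∘ tcomul D) ∘ totm f.
Proof.
rewrite -!compA fd compA fD -compA tcomul_d !compA; congr (_ ∘ _).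
by rewrite compDl compDr -!tenmM !comp1m !compm1 fd tsgn_totm0.
Qed.

Lemma comul_assoc_image :
  (assoc (bmon V) (tot E) (tot E) (tot E)
     ∘ ((tcomul D ⊠ idm (tot E)) ∘ tcomul D)) ∘ totm f
  = ((idm (tot E) ⊠ tcomul D) ∘ tcomul D) ∘ totm f.
Proof.
rewrite -!compA fD !tenA !comp1m fD ten_compl ten_compr -!compA.
by rewrite (compA _ (_ ⊠ totm f)) (assoc_nat (bmon V)) -!compA tcomul_assoc.
Qed.

End Transport.

End Laws.

(** * Gluing the homotopy between the identity and an idempotent *)

Section Gluing.

(** As graded objects, E is the direct sum of Z and of the suspension of the
    image of 1 - e.  The morphism ka is the projection of Z onto this image
    followed by the inclusion of the second summand, and th is the projection
    of E onto the second summand followed by the inclusion of the image in Z. *)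
Record is_gluing (K : fieldType) (V : basecat K) (Z E : graded V) (e : ghom 0 Z Z)
    (io : ghom 0 Z E) (ka : ghom (-1) Z E) (pi : ghom 0 E Z) (th : ghom 1 E Z) :
    Prop := IsGluing {
  gl_pi_io : totm pi ∘ totm io = idm (tot Z);
  gl_pi_ka : totm pi ∘ totm ka = 0;
  gl_th_io : totm th ∘ totm io = 0;
  gl_th_ka : totm th ∘ totm ka = idm (tot Z) - totm e;
  gl_split : totm io ∘ totm pi + totm ka ∘ totm th = idm (tot E)
}.

Variables (K : fieldType) (V : basecat K) (Z : cogc V) (e : cogc_hom Z Z).
Hypothesis eK : e ∘C e = e.
Variables (E : graded V) (io : ghom 0 Z E) (ka : ghom (-1) Z E)
  (pi : ghom 0 E Z) (th : ghom 1 E Z).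

Local Notation "'i'" := (totm io).
Local Notation "'k'" := (totm ka).
Local Notation "'π'" := (totm pi).
Local Notation "'θ'" := (totm th).
Local Notation "'ε'" := (totm e).
Local Notation "'d'" := (totm (cd Z)).
Local Notation "'Δ'" := (tcomul (comul Z)).
Local Notation "'τ'" := (tsgn _).

Hypothesis gl : is_gluing e io ka pi th.

Let pi_io := gl_pi_io gl.
Let pi_ka := gl_pi_ka gl.
Let th_io := gl_th_io gl.
Let th_ka := gl_th_ka gl.
Let E_split := gl_split gl.

Let epsK : ε ∘ ε = ε.
Proof. by rewrite -totm_cogc_comp eK. Qed.

Lemma glue_ext (Y : V) (u v : tot E ~> Y) :
  u ∘ i = v ∘ i -> u ∘ k = v ∘ k -> u = v.
Proof.
move=> uvi uvk; rewrite -[u]compm1 -[v]compm1 -E_split !compDr !compA.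
by rewrite uvi uvk.
Qed.

(** The homotopy factors through the image of 1 - e. *)
Lemma ka_e : k ∘ ε = 0.
Proof.
have: (i ∘ π + k ∘ θ) ∘ k = k by rewrite E_split comp1m.
rewrite compDl -!compA pi_ka th_ka compm0 add0r compDr compm1 compNr.
by move/eqP; rewrite addrC -subr_eq0 addrK oppr_eq0 => /eqP.
Qed.

(** The differential and the comultiplication are determined by the requirement
    that io be a morphism and ka a homotopy from io to io e. *)
Definition glue_d : ghom 1 E E :=
  io \oG (cd Z \oG pi)
  +G (io +G gopp (io \oG chom e) +G gopp (ka \oG cd Z)) \oG th.

Definition glue_comul : ghom 0 E (E ⊗G E) :=
  (io ⊠G io) \oG (comul Z \oG pi)
  +G ((io ⊠G ka +G ka ⊠G (io \oG chom e)) \oG comul Z) \oG th.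

Local Notation "'dE'" := (totm glue_d).
Local Notation "'ΔE'" := (tcomul glue_comul).

Lemma totm_glue_d : dE = i ∘ (d ∘ π) + (i - i ∘ ε - k ∘ d) ∘ θ.
Proof.
rewrite /glue_d totm_add (totm_comp io (cd Z \oG pi)) (totm_comp (cd Z) pi).
congr (_ + _); rewrite (totm_comp (q := 0) _ th) !totm_add !totm_opp.
by rewrite (totm_comp io e) (totm_comp ka (cd Z)).
Qed.

Lemma tcomul_glue :
  ΔE = (i ⊠ i) ∘ (Δ ∘ π) + ((i ∘ τ) ⊠ k + k ⊠ (i ∘ ε)) ∘ (Δ ∘ θ).
Proof.
rewrite !tcomulE /glue_comul totm_add compDr; congr (_ + _).
  rewrite (totm_comp (io ⊠G io) (comul Z \oG pi)) (totm_comp (comul Z) pi).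
  by rewrite compA nu_gtenm00 -!compA.
rewrite (totm_comp (q := -1) _ th) (totm_comp (q := -1) _ (comul Z)) totm_add
  !compA compDr.
rewrite nu_gtenm0N1 nu_gtenmN10.
by rewrite (totm_comp io e) -compDl -!compA.
Qed.

Lemma glue_d_io : dE ∘ i = i ∘ d.
Proof.
rewrite totm_glue_d compDl -!compA pi_io th_io compm0 addr0 compm1 //.
Qed.

Lemma glue_d_ka : dE ∘ k = i - i ∘ ε - k ∘ d.
Proof.
rewrite totm_glue_d compDl -!compA pi_ka th_ka !compm0 add0r compDr compm1.
rewrite compNr !compDl !compNl -compA epsK -[k ∘ d ∘ _]compA chom_totd compA ka_e.
by rewrite comp0m oppr0 addr0 subrr subr0.
Qed.

Lemma glue_comul_io : ΔE ∘ i = (i ⊠ i) ∘ Δ.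
Proof.
by rewrite tcomul_glue compDl -!compA pi_io th_io !compm0 addr0 compm1.
Qed.

Lemma glue_comul_ka : ΔE ∘ k = ((i ∘ τ) ⊠ k + k ⊠ (i ∘ ε)) ∘ Δ.
Proof.
have eE : Δ ∘ (idm (tot Z) - ε) = Δ - (ε ⊠ ε) ∘ Δ.
  by rewrite compDr compm1 compNr chom_tcomul.
rewrite tcomul_glue compDl -!compA pi_ka th_ka !compm0 add0r eE.
have kE : ((i ∘ τ) ⊠ k + k ⊠ (i ∘ ε)) ∘ (ε ⊠ ε) = 0.
  by rewrite compDl -!tenmM ka_e tenm0 ten0m addr0.
by rewrite compDr compNr (compA _ (ε ⊠ ε)) kE comp0m subr0.
Qed.

Lemma glue_dd : dE ∘ dE = 0.
Proof.
apply: glue_ext; rewrite comp0m; first exact: (dd_image glue_d_io).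
rewrite -compA.
rewrite glue_d_ka !compDr !compNr !compA glue_d_ka glue_d_io -!compA chom_totd.
rewrite !compDl !compNl -!compA totm_dd compm0 subr0.
by zmod_cancel.
Qed.

(** On the second summand the differentials of the two terms of the
    comultiplication contribute io ⊠ io e with opposite signs; what remains is
    the comultiplication of io - io e - ka d. *)
Lemma glue_comul_d : ΔE ∘ dE = (dE ⊠ idm (tot E) + tsgn E ⊠ dE) ∘ ΔE.
Proof.
apply: glue_ext; first exact: (comul_d_image glue_d_io glue_comul_io).
rewrite -!compA.
have [X XE] : exists X, X = (i ∘ τ) ⊠ k + k ⊠ (i ∘ ε) by eexists.
have lE : ΔE ∘ (i - i ∘ ε - k ∘ d)
    = (i ⊠ i - (i ⊠ i) ∘ (ε ⊠ ε) - X ∘ (d ⊠ idm _ + τ ⊠ d)) ∘ Δ.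
  rewrite (compDl (_ - _)) (compDl (_ ⊠ _)) !compNl -!compA -chom_tcomul
    -tcomul_d.
  by rewrite (compA X) XE -glue_comul_ka (compA _ Δ) -glue_comul_io !compDr
    !compNr -!compA.
rewrite glue_d_ka lE glue_comul_ka -XE compA; congr (_ ∘ _).
rewrite XE !compDl !compDr -!tenmM !comp1m !compm1 glue_d_ka.
have itd : i ∘ τ ∘ d = - (i ∘ d ∘ τ) by rewrite -compA tsgn_totm1 compNr compA.
have itt : i ∘ τ ∘ τ = i by rewrite -compA tsgnK compm1.
have dit : dE ∘ (i ∘ τ) = i ∘ d ∘ τ by rewrite compA glue_d_io.
have tit : τ ∘ (i ∘ τ) = i by rewrite compA tsgn_totm0 itt.
have tk : τ ∘ k = - (k ∘ τ) := tsgn_totmN1 ka.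
have die : dE ∘ (i ∘ ε) = i ∘ ε ∘ d by rewrite compA glue_d_io -!compA chom_totd.
rewrite itd itt dit tit tk die !tenDl !tenDr !tenNl !tenNr.
by zmod_cancel.
Qed.

(** On the second summand, both sides are the iterated comultiplication of Z
    followed by io ⊠ io ⊠ ka + io ⊠ ka ⊠ io e + ka ⊠ io e ⊠ io e, up to signs. *)
Lemma glue_comul_assoc :
  assoc (bmon V) (tot E) (tot E) (tot E) ∘ ((ΔE ⊠ idm (tot E)) ∘ ΔE)
  = (idm (tot E) ⊠ ΔE) ∘ ΔE.
Proof.
apply: glue_ext; first exact: (comul_assoc_image glue_comul_io).
rewrite -!compA.
rewrite !glue_comul_ka !(compA (_ ⊠ _) (_ + _)) !compDr -!tenmM !comp1m.
rewrite glue_comul_ka !(compA ΔE) !glue_comul_io -!compA -tsgn_tcomul chom_tcomul.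
rewrite !tenA !(ten_compl _ _ Δ) !(ten_compr _ _ _ Δ) -!compDl -!compA
  -tcomul_assoc.
rewrite !compA; congr (_ ∘ _ ∘ _).
by rewrite tenDl tenDr !compDl !compDr !(assoc_nat (bmon V)) addrA.
Qed.

End Gluing.

(** * Exhaustive sequences of subobjects *)

Section Abelian.
Variables (K : fieldType) (C : lincat K).

Lemma kernel_monic (X Y Z : C) (k : X ~> Y) (f : Y ~> Z) : is_kernel k f ->
  monic k.
Proof.
move=> [fk kU] W u v uv.
have [|w [_ wU]] := kU _ (k ∘ v); first by rewrite compA fk comp0m.
by rewrite -(wU u) // -(wU v).
Qed.

Lemma cokernel_epic (X Y Z : C) (q : Y ~> Z) (f : X ~> Y) : is_cokernel q f ->
  epic q.
Proof.
move=> [qf qU] W u v uv.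
have [|w [_ wU]] := qU _ (v ∘ q); first by rewrite -compA qf compm0.
by rewrite -(wU u) // -(wU v).
Qed.

Hypothesis abC : abelian C.

Lemma monic_kernel_cokernel (X Y Z : C) (k : X ~> Y) (q : Y ~> Z) :
  monic k -> is_cokernel q k -> is_kernel k q.
Proof.
move=> km [qk qU]; split=> // W u qu.
have [Z' [g [gk gU]]] := ab_monic abC km.
have [g' [g'q _]] := qU _ g gk.
by apply: gU; rewrite -g'q -compA qu compm0.
Qed.

Lemma monic_epic_iso (X Y : C) (f : X ~> Y) : monic f -> epic f -> is_iso f.
Proof.
move=> fm fe; have [W [g [fg fU]]] := ab_epic abC fe.
have g0 : g = 0 by apply: fm; rewrite fg compm0.
have [|v [vf _]] := fU _ (idm X); first by rewrite g0 compm0.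
exists v; split=> //; apply: fe.
by rewrite -compA vf compm1 comp1m.
Qed.

End Abelian.

(** A sequence of subobjects is a diagram on the ordered set of the natural
    numbers, whose transition maps are determined by the inclusions. *)
Definition nat_poset : smallcat :=
  @SmallCat nat (fun m n => (m <= n)%N : Type) leqnn
    (fun i j k v u => leq_trans u v)
    (fun _ _ _ _ _ _ _ => bool_irrelevance _ _)
    (fun _ _ _ => bool_irrelevance _ _) (fun _ _ _ => bool_irrelevance _ _).

Lemma nat_poset_filtered : filtered nat_poset.
Proof.
split=> [|m n|m n u v]; first by exists; exact: 0%N.
  by exists (maxn m n), (leq_maxl m n), (leq_maxr m n).
by exists n, (leqnn n); apply: bool_irrelevance.
Qed.

Section SequentialUnion.
Variables (K : fieldType) (V : basecat K) (X : V) (N : nat -> V).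
Variables (k : forall n, N n ~> X) (t : forall n, N n ~> N n.+1).
Hypotheses (kt : forall n, k n.+1 ∘ t n = k n) (km : forall n, monic (k n)).

Lemma union_incl_ex m n : (m <= n)%N -> exists u : N m ~> N n, k n ∘ u = k m.
Proof.
move=> /subnK <-; elim: (n - m)%N => [|l [u uE]].
  by exists (idm _); rewrite compm1.
by exists (t _ ∘ u); rewrite compA kt.
Qed.

Definition union_incl m n (mn : (m <= n)%N) : N m ~> N n :=
  sval (cid (union_incl_ex mn)).

Lemma union_inclE m n (mn : (m <= n)%N) : k n ∘ union_incl mn = k m.
Proof. exact: svalP (cid (union_incl_ex mn)). Qed.

Lemma union_incl1 (n : nat_poset) : union_incl (sid n) = idm (N n).
Proof. by apply: km; rewrite union_inclE compm1. Qed.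

Lemma union_inclM (l m n : nat_poset) (v : shom m n) (u : shom l m) :
  union_incl (scomp v u) = union_incl v ∘ union_incl u.
Proof. by apply: km; rewrite compA !union_inclE. Qed.

Definition union_diagram : diagram V nat_poset := Diagram union_incl1 union_inclM.

Definition const_diagram : diagram V nat_poset :=
  @Diagram _ V nat_poset (fun=> X) (fun _ _ _ => idm X) (fun=> erefl)
    (fun _ _ _ _ _ => esym (comp1m _)).

Lemma const_colimit : is_colimit (D := const_diagram) (fun=> idm X).
Proof.
split=> [m n u|Y c cP]; first by rewrite compm1.
exists (c 0%N); split=> [n|w /(_ 0%N)]; last by rewrite compm1.
by rewrite compm1 -(cP _ _ (leq0n n : shom (s := nat_poset) 0%N n)) compm1.
Qed.

Let quot_sig n := cid (ab_cokernel (bcat_abelian V) (k n)).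
Let Q n : V := sval (quot_sig n).
Let q n : X ~> Q n := sval (cid (svalP (quot_sig n))).
Let qP n : is_cokernel (q n) (k n) := svalP (cid (svalP (quot_sig n))).

Let quot_map_ex m n (mn : (m <= n)%N) : exists u : Q m ~> Q n, u ∘ q m = q n.
Proof.
have [_ /(_ _ (q n))] := qP m.
case=> [|u [uE _]]; last by exists u.
by rewrite -(union_inclE mn) compA (proj1 (qP n)) comp0m.
Qed.
Let quot_map m n (mn : (m <= n)%N) : Q m ~> Q n := sval (cid (quot_map_ex mn)).
Let quot_mapE m n (mn : (m <= n)%N) : quot_map mn ∘ q m = q n :=
  svalP (cid (quot_map_ex mn)).

Let quot_map1 (n : nat_poset) : quot_map (sid n) = idm (Q n).
Proof. by apply: (cokernel_epic (qP n)); rewrite quot_mapE comp1m. Qed.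
Let quot_mapM (l m n : nat_poset) (v : shom m n) (u : shom l m) :
  quot_map (scomp v u) = quot_map v ∘ quot_map u.
Proof. by apply: (cokernel_epic (qP l)); rewrite -compA !quot_mapE. Qed.
Let quot_diagram : diagram V nat_poset := Diagram quot_map1 quot_mapM.

(** By exactness of filtered colimits the colimit of the subobjects embeds into
    X; the embedding is epic as soon as the subobjects are jointly epic. *)
Lemma union_seq_colimit :
  (forall (Y : V) (u v : X ~> Y), (forall n, u ∘ k n = v ∘ k n) -> u = v) ->
  is_seq_colimit t k.
Proof.
move=> kepi.
have [L [c cL]] := bcat_cocomplete union_diagram.
have [L3 [c3 c3L]] := bcat_cocomplete quot_diagram.
have [u [uE _]] : exists! u : L ~> X, forall n, u ∘ c n = k n.
  by apply: (proj2 cL) => m n mn; apply: union_inclE.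
have vE n : (c3 0%N ∘ q 0%N) ∘ idm X = c3 n ∘ q n.
  have n0 : shom (s := nat_poset) 0%N n := leq0n n.
  by rewrite compm1 -(quot_mapE n0) compA (proj1 c3L _ _ n0).
have [uker _] : short_exact u (c3 0%N ∘ q 0%N).
  refine (@bcat_exact_filtered _ V nat_poset union_diagram const_diagram
    quot_diagram k q L X L3 c (fun=> idm X) c3 u _ nat_poset_filtered _ _ _ cL
    const_colimit c3L _ vE) => [m n mn|m n mn|n|n].
  - by rewrite comp1m; apply: union_inclE.
  - by rewrite compm1; apply/esym/quot_mapE.
  - split; last exact: qP.
    exact: (monic_kernel_cokernel (bcat_abelian V) (@km n) (qP n)).
  - by rewrite comp1m.
have [|w [wu uw]] := monic_epic_iso (bcat_abelian V) (kernel_monic uker).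
  by move=> Y a b ab; apply: kepi => n; rewrite -uE !compA ab.
split=> // Y c' c'P.
have c'E m n (mn : (m <= n)%N) : c' n ∘ union_incl mn = c' m.
  have [u0 u0E <-] : exists2 u0, k n ∘ u0 = k m & c' n ∘ u0 = c' m.
    move: (mn) => /subnK <-; elim: (n - m)%N => [|l [u0 u0E c0E]].
      by exists (idm _); rewrite compm1.
    by exists (t _ ∘ u0); rewrite compA ?kt ?c'P.
  by congr (_ ∘ _); apply: km; rewrite union_inclE.
have [v [vE' vU]] := proj2 cL Y c' c'E.
exists (v ∘ w); split=> [n|v' v'E]; first by rewrite -uE -compA (compA w) wu
  comp1m.
rewrite -[v']compm1 -uw compA; congr (_ ∘ _); apply: vU => n.
by rewrite -compA uE v'E.
Qed.

End SequentialUnion.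

(** * Tensor powers of morphisms and homotopies *)

Section Powers.
Variables (K : fieldType) (V : basecat K).
Implicit Types M N : graded V.

(** The sum of the f ⊗ .. ⊗ f ⊗ h ⊗ g ⊗ .. ⊗ g with n + 1 factors, which is the
    usual homotopy between the tensor powers of f and of g. *)
Fixpoint hpow M N (f g : ghom 0 M N) (h : ghom (-1) M N) (n : nat) :
    ghom (-1) (tpow M n) (tpow N n) :=
  if n is n'.+1 then f ⊠G hpow f g h n' +G (h ⊠G tpowm g n' : ghom (-1) _ _)
  else h.

Lemma nu_tpowmS M N (f : ghom 0 M N) n :
  nu N (tpow N n) ∘ totm (tpowm f n.+1)
  = (totm f ⊠ totm (tpowm f n)) ∘ nu M (tpow M n).
Proof. exact: nu_gtenm00. Qed.

Lemma nu_hpowS M N (f g : ghom 0 M N) (h : ghom (-1) M N) n :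
  nu N (tpow N n) ∘ totm (hpow f g h n.+1)
  = ((totm f ∘ tsgn M) ⊠ totm (hpow f g h n) + totm h ⊠ totm (tpowm g n))
      ∘ nu M (tpow M n).
Proof.
by rewrite [hpow f g h n.+1]/= totm_add compDr nu_gtenm0N1 nu_gtenmN10 -compDl.
Qed.

Lemma nu_itcomulS (X : dgcoalg V) n :
  nu X (tpow X n) ∘ totm (itcomul X n.+1)
  = (idm (tot X) ⊠ totm (itcomul X n)) ∘ tcomul (comul X).
Proof.
rewrite [itcomul X n.+1]/= tcomulE (totm_comp (gid X ⊠G itcomul X n) (comul X)).
by rewrite compA nu_gtenm00 totm_id -!compA.
Qed.


Lemma itcomul_hom (X Y : dgcoalg V) (f : ghom 0 X Y) n :
  comul Y \oG f = (f ⊠G f) \oG comul X :> ghom 0 X (Y ⊗G Y) ->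
  totm (itcomul Y n) ∘ totm f = totm (tpowm f n) ∘ totm (itcomul X n).
Proof.
move=> /comultE fD; elim: n => [|n IHn]; first by rewrite !totm_id comp1m compm1.
apply: nu_mono; rewrite !compA nu_itcomulS nu_tpowmS -!compA nu_itcomulS.
by rewrite fD !tenA comp1m compm1 IHn.
Qed.

(** A coderivation is compatible with the iterated comultiplications for the
    same reason as a morphism; so it maps their kernels into one another. *)
Lemma itcomul_coderivation (X Y : dgcoalg V) (f g : ghom 0 X Y)
    (h : ghom (-1) X Y) n :
  comul Y \oG g = (g ⊠G g) \oG comul X :> ghom 0 X (Y ⊗G Y) ->
  comul Y \oG h = (f ⊠G h +G h ⊠G g) \oG comul X :> ghom (-1) X (Y ⊗G Y) ->
  totm (itcomul Y n) ∘ totm h = totm (hpow f g h n) ∘ totm (itcomul X n).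
Proof.
move=> gD /coderivationE hD; elim: n => [|n IHn].
  by rewrite !totm_id comp1m compm1.
apply: nu_mono; rewrite !compA nu_itcomulS nu_hpowS -!compA nu_itcomulS.
rewrite hD !compA; congr (_ ∘ _).
by rewrite compDr compDl -!tenmM !comp1m !compm1 IHn (itcomul_hom n gD).
Qed.

End Powers.

(** * Cocompleteness *)

Section Cocompleteness.
Variables (K : fieldType) (V : basecat K).

Lemma itcomulS_factor (X : dgcoalg V) n :
  exists G : ghom 0 (tpow X n) (tpow X n.+1), itcomul X n.+1 = G \oG itcomul X n.
Proof.
elim: n => [|n [G GE]].
  exists (comul X); apply: totm_inj; apply: nu_mono.
  rewrite (nu_itcomulS X 0) [itcomul X 0]/= totm_id tenm1 comp1m
    (totm_comp (comul X) (gid X)) totm_id.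
  by rewrite compm1 tcomulE.
exists (gid X ⊠G G); apply: totm_inj; apply: nu_mono.
rewrite (nu_itcomulS X n.+1) (totm_comp (gid X ⊠G G) (itcomul X n.+1)) compA.
rewrite nu_gtenm00 -compA (nu_itcomulS X n) tenA totm_id comp1m.
by rewrite -(totm_comp G (itcomul X n)) -GE.
Qed.

Lemma cocomplete_epic (X : dgcoalg V) (i : int) (Y : V) (u v : cgr X i ~> Y) :
  coalg_cocomplete X ->
  (forall n (W : V) (w : W ~> cgr X i), itcomul X n i i ∘ w = 0 -> u ∘ w = v ∘ w) ->
  u = v.
Proof.
move=> /(_ i) [N [k [t [kP [kt kU]]]]] uv.
have [n|w [_ wU]] := kU Y (fun n => v ∘ k n); first by rewrite -compA kt.
rewrite -(wU v) // -(wU u) // => n.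
by apply: (uv n); case: (kP n).
Qed.

(** The kernels of the iterated comultiplications increase because each
    iterate factors through the preceding one. *)
Lemma epic_cocomplete (X : dgcoalg V) :
  (forall (i : int) (Y : V) (u v : cgr X i ~> Y),
    (forall n (W : V) (w : W ~> cgr X i), itcomul X n i i ∘ w = 0 -> u ∘ w = v ∘ w) ->
    u = v) ->
  coalg_cocomplete X.
Proof.
move=> Xepi i.
pose ks n := cid (ab_kernel (bcat_abelian V) (itcomul X n i i)).
pose N n : V := sval (ks n).
pose k n : N n ~> cgr X i := sval (cid (svalP (ks n))).
have kP n : is_kernel (k n) (itcomul X n i i) := svalP (cid (svalP (ks n))).
have tex n : exists t : N n ~> N n.+1, k n.+1 ∘ t = k n.
  have [_ /(_ _ (k n))] := kP n.+1.
  case=> [|t [tE _]]; last by exists t.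
  have [G GE] := itcomulS_factor X n.
  have -> : itcomul X n.+1 i i = (G \oG itcomul X n) i i by rewrite GE.
  by rewrite gcomp0E -compA (proj1 (kP n)) compm0.
exists N, k, (fun n => sval (cid (tex n))); split=> //.
apply: union_seq_colimit => [n|n|Y u v uv]; first exact: svalP (cid (tex n)).
  exact: kernel_monic (kP n).
apply: Xepi => n W w /(proj2 (kP n)) [w' [<- _]].
by rewrite !compA uv.
Qed.

(** The factorizations ensure that phi maps the kernels of the iterated
    comultiplications of Z into those of E; as the former exhaust Z, the latter
    exhaust what the morphisms phi cover. *)
Lemma covered_cocomplete (E : dgcoalg V) :
  (forall (i : int) (Y : V) (u v : cgr E i ~> Y),
    (forall (Z : dgcoalg V) a (phi : cgr Z a ~> cgr E i), coalg_cocomplete Z ->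
      (forall n, exists psi, itcomul E n i i ∘ phi = psi ∘ itcomul Z n a a) ->
      u ∘ phi = v ∘ phi) ->
    u = v) ->
  coalg_cocomplete E.
Proof.
move=> Ecov; apply: epic_cocomplete => i Y u v uv.
apply: Ecov => Z a phi Zco phiP; apply: cocomplete_epic Zco _ => n W w Zw.
rewrite -!compA; apply: (uv n); have [psi psiE] := phiP n.
by rewrite compA psiE -compA Zw compm0.
Qed.

Lemma itcomul_hom_factor (X Y : dgcoalg V) (f : ghom 0 X Y) i n :
  comul Y \oG f = (f ⊠G f) \oG comul X :> ghom 0 X (Y ⊗G Y) ->
  exists psi, itcomul Y n i i ∘ f i i = psi ∘ itcomul X n i i.
Proof.
move=> /(itcomul_hom n); rewrite -(totm_comp (itcomul Y n) f).
rewrite -(totm_comp (tpowm f n) (itcomul X n)) => /totm_inj e.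
by exists (tpowm f n i i); rewrite -!gcomp0E e.
Qed.

Lemma itcomul_coderivation_factor (X Y : dgcoalg V) (f g : ghom 0 X Y)
    (h : ghom (-1) X Y) i n :
  comul Y \oG g = (g ⊠G g) \oG comul X :> ghom 0 X (Y ⊗G Y) ->
  comul Y \oG h = (f ⊠G h +G h ⊠G g) \oG comul X :> ghom (-1) X (Y ⊗G Y) ->
  exists psi, itcomul Y n (i - 1) (i - 1) ∘ h i (i - 1) = psi ∘ itcomul X n i i.
Proof.
move=> gD hD; exists (hpow f g h n i (i - 1)).
have := itcomul_coderivation n gD hD; rewrite -(totm_comp (itcomul Y n) h).
rewrite -(totm_comp (hpow f g h n) (itcomul X n)) => /totm_inj.
move=> /(congr1 (fun u : ghom (-1) _ _ => u i (i - 1))) /=.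
by rewrite addr0.
Qed.

End Cocompleteness.

(** * Direct sums of graded objects *)

Section GradedSums.
Variables (K : fieldType) (V : basecat K).
Implicit Types M N S : graded V.

Record is_graded_sum M N S (i1 : ghom 0 M S) (i2 : ghom 0 N S)
    (p1 : ghom 0 S M) (p2 : ghom 0 S N) : Prop := GradedSum {
  gs_11 : totm p1 ∘ totm i1 = idm (tot M);
  gs_22 : totm p2 ∘ totm i2 = idm (tot N);
  gs_12 : totm p1 ∘ totm i2 = 0;
  gs_21 : totm p2 ∘ totm i1 = 0;
  gs_sum : totm i1 ∘ totm p1 + totm i2 ∘ totm p2 = idm (tot S)
}.

Lemma totm_diag2 M N S (g : forall i, N i ~> S i) (f : forall i, M i ~> N i) i :
  totm (gdiag g) ∘ totm (gdiag f) ∘ tin M i = tin S i ∘ (g i ∘ f i).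
Proof. by rewrite -compA totm_diag compA totm_diag -compA. Qed.

Lemma graded_sum_exists M N :
  exists (S : graded V) (i1 : ghom 0 M S) (i2 : ghom 0 N S)
    (p1 : ghom 0 S M) (p2 : ghom 0 S N), is_graded_sum i1 i2 p1 p2.
Proof.
pose Ss i := cid (ab_biproduct (bcat_abelian V) (M i) (N i)).
pose S : graded V := fun i => sval (Ss i).
pose i1s i := cid (svalP (Ss i)); pose i2s i := cid (svalP (i1s i)).
pose p1s i := cid (svalP (i2s i)); pose p2s i := cid (svalP (p1s i)).
exists S, (gdiag (fun i => sval (i1s i))), (gdiag (fun i => sval (i2s i))).
exists (gdiag (fun i => sval (p1s i))), (gdiag (fun i => sval (p2s i))).
have sE i := svalP (p2s i).
split; apply: tot_ext => i; rewrite ?compDl !totm_diag2 -?compDr;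
  have [e11 e22 e12 e21 e] := sE i.
- by rewrite e11 compm1 comp1m.
- by rewrite e22 compm1 comp1m.
- by rewrite e12 compm0 comp0m.
- by rewrite e21 compm0 comp0m.
- by rewrite e compm1 comp1m.
Qed.

Definition susp M : graded V := fun i => M (i + 1).

Lemma to_susp_subproof M (i j : int) : j != i - 1 -> deltam M i (j + 1) = 0.
Proof. by move=> ij; rewrite deltam_neq // -subr_eq eq_sym. Qed.
Definition to_susp M : ghom (-1) M (susp M) := GHom (to_susp_subproof M).

Lemma of_susp_subproof M (i j : int) : j != i + 1 -> deltam M (i + 1) j = 0.
Proof. by rewrite eq_sym; exact: deltam_neq. Qed.
Definition of_susp M : ghom 1 (susp M) M := GHom (of_susp_subproof M).

Lemma of_suspK M : totm (to_susp M) ∘ totm (of_susp M) = idm (tot (susp M)).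
Proof.
apply: tot_ext => i; rewrite -compA (totmE _ erefl) compA.
rewrite (totmE (to_susp M) (j := i)) ?addrK //=.
by rewrite !deltam_id !compm1 comp1m.
Qed.

Lemma to_suspK M : totm (of_susp M) ∘ totm (to_susp M) = idm (tot M).
Proof.
apply: tot_ext => i; rewrite -compA (totmE _ erefl) compA.
rewrite (totmE (of_susp M) (j := i)) ?subrK //=.
by rewrite /susp !tin_deltam ?subrK // comp1m.
Qed.

End GradedSums.

(** * Building coalgebras and their morphisms from total objects *)

Section Build.
Variables (K : fieldType) (V : basecat K).

Definition dgcoalg_of (E : graded V) (d : ghom 1 E E) (D : ghom 0 E (E ⊗G E))
    (dd : totm d ∘ totm d = 0)
    (DA : assoc (bmon V) (tot E) (tot E) (tot E)
            ∘ ((tcomul D ⊠ idm (tot E)) ∘ tcomul D)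
          = (idm (tot E) ⊠ tcomul D) ∘ tcomul D)
    (Dd : tcomul D ∘ totm d
          = (totm d ⊠ idm (tot E) + tsgn E ⊠ totm d) ∘ tcomul D) : dgcoalg V :=
  @DGCoalg _ _ (Complex (proj2 (differentialE d) dd)) D
    (proj2 (coassocE D) DA) (proj2 (comul_dE D d) Dd).

Definition cogc_hom_of (X Y : cogc V) (f : ghom 0 X Y)
    (fd : totm (cd Y) ∘ totm f = totm f ∘ totm (cd X))
    (fD : tcomul (comul Y) ∘ totm f = (totm f ⊠ totm f) ∘ tcomul (comul X)) :
    cogc_hom X Y :=
  CogcHom (proj2 (chain_mapE (cd X) (cd Y) f) fd)
    (proj2 (comultE (comul X) (comul Y) f) fD).

(** The conditions on a classical homotopy, for morphisms of graded objects that
    need not be known to be morphisms of dg coalgebras. *)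
Record homotopyT (X Y : dgcoalg V) (f g : ghom 0 X Y) (h : ghom (-1) X Y) : Prop :=
  HomotopyT {
    hom_comul : tcomul (comul Y) ∘ totm h
      = ((totm f ∘ tsgn X) ⊠ totm h + totm h ⊠ totm g) ∘ tcomul (comul X);
    hom_d : totm (cd Y) ∘ totm h + totm h ∘ totm (cd X) = totm f - totm g
  }.

Lemma classically_homotopicE (X Y : cogc V) (f g : cogc_hom X Y) :
  classically_homotopic f g <-> exists h, homotopyT f g h.
Proof.
by split=> -[h [hD hd]]; exists h; split;
  do ?[exact/coderivationE | exact/homotopyE].
Qed.

End Build.

(** * Binary coproducts *)

Section Coproducts.
Variables (K : fieldType) (V : basecat K) (X Y : cogc V).

Section Sum.
Variables (S : graded V) (i1 : ghom 0 X S) (i2 : ghom 0 Y S).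
Variables (p1 : ghom 0 S X) (p2 : ghom 0 S Y).
Hypothesis sumS : is_graded_sum i1 i2 p1 p2.

Lemma sum_ext (T : V) (u v : tot S ~> T) :
  u ∘ totm i1 = v ∘ totm i1 -> u ∘ totm i2 = v ∘ totm i2 -> u = v.
Proof.
move=> uv1 uv2; rewrite -[u]compm1 -[v]compm1 -(gs_sum sumS) !compDr !compA.
by rewrite uv1 uv2.
Qed.

Definition sum_d : ghom 1 S S :=
  i1 \oG (cd X \oG p1) +G i2 \oG (cd Y \oG p2).

Definition sum_comul : ghom 0 S (S ⊗G S) :=
  (i1 ⊠G i1) \oG (comul X \oG p1) +G (i2 ⊠G i2) \oG (comul Y \oG p2).

Lemma totm_sum_d : totm sum_d
  = totm i1 ∘ (totm (cd X) ∘ totm p1) + totm i2 ∘ (totm (cd Y) ∘ totm p2).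
Proof.
rewrite /sum_d totm_add (totm_comp i1 (cd X \oG p1)) (totm_comp i2 (cd Y \oG p2)).
by rewrite (totm_comp (cd X) p1) (totm_comp (cd Y) p2).
Qed.

Lemma tcomul_sum : tcomul sum_comul
  = (totm i1 ⊠ totm i1) ∘ (tcomul (comul X) ∘ totm p1)
    + (totm i2 ⊠ totm i2) ∘ (tcomul (comul Y) ∘ totm p2).
Proof.
rewrite !tcomulE /sum_comul totm_add compDr.
rewrite (totm_comp (i1 ⊠G i1) (comul X \oG p1)) (totm_comp (comul X) p1).
rewrite (totm_comp (i2 ⊠G i2) (comul Y \oG p2)) (totm_comp (comul Y) p2).
by rewrite !(compA (nu S S)) !nu_gtenm00 -!compA.
Qed.

Lemma sum_d_in1 : totm sum_d ∘ totm i1 = totm i1 ∘ totm (cd X).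
Proof.
by rewrite totm_sum_d compDl -!compA (gs_11 sumS) (gs_21 sumS) !compm0 compm1
  addr0.
Qed.

Lemma sum_d_in2 : totm sum_d ∘ totm i2 = totm i2 ∘ totm (cd Y).
Proof.
by rewrite totm_sum_d compDl -!compA (gs_12 sumS) (gs_22 sumS) !compm0 compm1
  add0r.
Qed.

Lemma sum_comul_in1 :
  tcomul sum_comul ∘ totm i1 = (totm i1 ⊠ totm i1) ∘ tcomul (comul X).
Proof.
by rewrite tcomul_sum compDl -!compA (gs_11 sumS) (gs_21 sumS) !compm0 compm1
  addr0.
Qed.

Lemma sum_comul_in2 :
  tcomul sum_comul ∘ totm i2 = (totm i2 ⊠ totm i2) ∘ tcomul (comul Y).
Proof.
by rewrite tcomul_sum compDl -!compA (gs_12 sumS) (gs_22 sumS) !compm0 compm1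
  add0r.
Qed.

Lemma sum_dd : totm sum_d ∘ totm sum_d = 0.
Proof.
apply: sum_ext; rewrite comp0m; first exact: (dd_image sum_d_in1).
exact: (dd_image sum_d_in2).
Qed.

Lemma sum_comul_d : tcomul sum_comul ∘ totm sum_d
  = (totm sum_d ⊠ idm (tot S) + tsgn S ⊠ totm sum_d) ∘ tcomul sum_comul.
Proof.
apply: sum_ext; first exact: (comul_d_image sum_d_in1 sum_comul_in1).
exact: (comul_d_image sum_d_in2 sum_comul_in2).
Qed.

Lemma sum_comul_assoc :
  assoc (bmon V) (tot S) (tot S) (tot S)
    ∘ ((tcomul sum_comul ⊠ idm (tot S)) ∘ tcomul sum_comul)
  = (idm (tot S) ⊠ tcomul sum_comul) ∘ tcomul sum_comul.
Proof.
apply: sum_ext; first exact: (comul_assoc_image sum_comul_in1).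
exact: (comul_assoc_image sum_comul_in2).
Qed.

Definition sum_dgcoalg : dgcoalg V := dgcoalg_of sum_dd sum_comul_assoc
  sum_comul_d.

Lemma sum_cocomplete : coalg_cocomplete sum_dgcoalg.
Proof.
apply: covered_cocomplete => i T u v uv.
have uv1 : u ∘ i1 i i = v ∘ i1 i i.
  apply: (uv X) => [|n]; first exact: cogc_cocomplete.
  by apply: (itcomul_hom_factor (Y := sum_dgcoalg)); apply/comultE/sum_comul_in1.
have uv2 : u ∘ i2 i i = v ∘ i2 i i.
  apply: (uv Y) => [|n]; first exact: cogc_cocomplete.
  by apply: (itcomul_hom_factor (Y := sum_dgcoalg)); apply/comultE/sum_comul_in2.
have : i1 \oG p1 +G i2 \oG p2 = gid S :> ghom 0 S S.
  by apply: totm_inj; rewrite totm_id -(gs_sum sumS) -!totm_comp -totm_add.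
move=> /(congr1 (fun f : ghom 0 S S => f i i)) /=; rewrite !addr0 deltam_id => sE.
by rewrite -[u]compm1 -[v]compm1 -sE !compDr !compA uv1 uv2.
Qed.

Definition sum_cogc : cogc V := Cogc sum_cocomplete.

End Sum.

Lemma cogc_coproduct_exists : exists (S : cogc V) (i1 : cogc_hom X S)
    (i2 : cogc_hom Y S) (p1 : ghom 0 S X) (p2 : ghom 0 S Y),
  is_cogc_coproduct i1 i2 /\ is_graded_sum i1 i2 p1 p2.
Proof.
have [S [i1 [i2 [p1 [p2 sumS]]]]] := graded_sum_exists X Y.
exists (sum_cogc sumS).
exists (@cogc_hom_of _ _ X (sum_cogc sumS) i1
  (sum_d_in1 sumS) (sum_comul_in1 sumS)).
exists (@cogc_hom_of _ _ Y (sum_cogc sumS) i2 (sum_d_in2 sumS) (sum_comul_in2 sumS)), p1, p2.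
split=> // Z u v.
pose w : ghom 0 S Z := u \oG p1 +G v \oG p2.
have wE : totm w = totm u ∘ totm p1 + totm v ∘ totm p2.
  by rewrite /w totm_add (totm_comp u p1) (totm_comp v p2).
have w1 : totm w ∘ totm i1 = totm u.
  by rewrite wE compDl -!compA (gs_11 sumS) (gs_21 sumS) compm0 compm1 addr0.
have w2 : totm w ∘ totm i2 = totm v.
  by rewrite wE compDl -!compA (gs_12 sumS) (gs_22 sumS) compm0 compm1 add0r.
have wd : totm (cd Z) ∘ totm w = totm w ∘ totm (sum_d i1 i2 p1 p2).
  apply: (sum_ext sumS); rewrite -!compA ?(sum_d_in1 sumS) ?(sum_d_in2 sumS)
    ?w1 ?w2.
    by rewrite chom_totd compA w1.
  by rewrite chom_totd compA w2.
have wD : tcomul (comul Z) ∘ totm w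
    = (totm w ⊠ totm w) ∘ tcomul (sum_comul i1 i2 p1 p2).
  apply: (sum_ext sumS); rewrite -!compA ?(sum_comul_in1 sumS)
    ?(sum_comul_in2 sumS).
    by rewrite w1 chom_tcomul tenA w1.
  by rewrite w2 chom_tcomul tenA w2.
exists (@cogc_hom_of _ _ (sum_cogc sumS) Z w wd wD); split.
  by split; apply: cogc_hom_inj; rewrite totm_cogc_comp.
move=> w' [w'1 w'2]; apply: cogc_hom_inj; apply: (sum_ext sumS).
  by rewrite w1 -w'1 totm_cogc_comp.
by rewrite w2 -w'2 totm_cogc_comp.
Qed.

End Coproducts.

(** * Existence of the glued coalgebra *)

Section GluingExists.
Variables (K : fieldType) (V : basecat K) (Z : cogc V) (e : cogc_hom Z Z).
Hypothesis eK : e ∘C e = e.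

(** The image of the idempotent 1 - e is the kernel of e. *)
Lemma is_gluing_exists : exists (E : graded V) (io : ghom 0 Z E)
  (ka : ghom (-1) Z E) (pi : ghom 0 E Z) (th : ghom 1 E Z),
  is_gluing e io ka pi th.
Proof.
have eeE i : chom e i i ∘ chom e i i = chom e i i.
  by rewrite -{3}eK -gcomp0E.
pose Ks i := cid (ab_kernel (bcat_abelian V) (chom e i i)).
pose M : graded V := fun i => sval (Ks i).
pose k i : M i ~> cgr Z i := sval (cid (svalP (Ks i))).
have kP i : is_kernel (k i) (chom e i i) := svalP (cid (svalP (Ks i))).
have rex i : exists r : cgr Z i ~> M i, k i ∘ r = idm _ - chom e i i.
  have [_ /(_ _ (idm _ - chom e i i))] := kP i.
  case=> [|r [rE _]]; last by exists r.
  by rewrite compDr compm1 compNr eeE subrr.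
pose r i := sval (cid (rex i)).
have krE i : k i ∘ r i = idm _ - chom e i i := svalP (cid (rex i)).
have rkE i : r i ∘ k i = idm (M i).
  apply: (kernel_monic (kP i)); rewrite compA krE compDl compNl (proj1 (kP i)).
  by rewrite comp1m subr0 compm1.
have trk : totm (gdiag r) ∘ totm (gdiag k) = idm (tot M).
  by apply: tot_ext => i; rewrite totm_diag2 rkE compm1 comp1m.
have tkr : totm (gdiag k) ∘ totm (gdiag r) = idm (tot Z) - totm e.
  apply: tot_ext => i; rewrite totm_diag2 krE compDr compDl compm1 comp1m.
  by rewrite compNr compNl (totmE _ (j := i)) ?addr0.
have [E [i1 [i2 [p1 [p2 sumE]]]]] := graded_sum_exists Z (susp M).
pose th : ghom 1 E Z := (gdiag k \oG of_susp M) \oG p2.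
pose ka : ghom (-1) Z E := i2 \oG (to_susp M \oG gdiag r).
have thE : totm th = totm (gdiag k) ∘ totm (of_susp M) ∘ totm p2.
  by rewrite /th (totm_comp (gdiag k \oG of_susp M) p2)
    (totm_comp (gdiag k) (of_susp M)).
have kaE : totm ka = totm i2 ∘ (totm (to_susp M) ∘ totm (gdiag r)).
  by rewrite /ka (totm_comp i2 (to_susp M \oG gdiag r))
    (totm_comp (to_susp M) (gdiag r)).
exists E, i1, ka, p1, th; split.
- exact: gs_11 sumE.
- by rewrite kaE compA (gs_12 sumE) comp0m.
- by rewrite thE -compA (gs_21 sumE) compm0.
- rewrite thE kaE -!compA (compA (totm p2)) (gs_22 sumE) comp1m.
  by rewrite (compA (totm (of_susp M))) to_suspK comp1m.
- rewrite thE kaE -!compA (compA (totm (gdiag r))) trk comp1m.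
  by rewrite (compA (totm (to_susp M))) of_suspK comp1m (gs_sum sumE).
Qed.

Section Object.
Variables (E : graded V) (io : ghom 0 Z E) (ka : ghom (-1) Z E)
  (pi : ghom 0 E Z) (th : ghom 1 E Z).
Hypothesis gl : is_gluing e io ka pi th.

Definition glue_dgcoalg : dgcoalg V :=
  dgcoalg_of (glue_dd eK gl) (glue_comul_assoc gl) (glue_comul_d eK gl).

Lemma glue_io_comul :
  comul glue_dgcoalg \oG io = (io ⊠G io) \oG comul Z :> ghom 0 Z (E ⊗G E).
Proof. by apply/comultE; exact: (glue_comul_io gl). Qed.

Lemma glue_homotopy : homotopyT (Y := glue_dgcoalg) io (io \oG chom e) ka.
Proof.
split; rewrite (totm_comp io e); first exact: (glue_comul_ka gl).
by rewrite [totm (cd glue_dgcoalg) ∘ _](glue_d_ka eK gl) subrK.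
Qed.

Lemma glue_cocomplete : coalg_cocomplete glue_dgcoalg.
Proof.
apply: covered_cocomplete => i' T; have [i ->] : exists i, i' = i - 1.
  by exists (i' + 1); rewrite addrK.
move=> u v uv.
have uvio : u ∘ io (i - 1) (i - 1) = v ∘ io (i - 1) (i - 1).
  apply: (uv Z) => [|n]; first exact: cogc_cocomplete.
  exact: (itcomul_hom_factor (Y := glue_dgcoalg) _ _ glue_io_comul).
have uvka : u ∘ ka i (i - 1) = v ∘ ka i (i - 1).
  apply: (uv Z) => [|n]; first exact: cogc_cocomplete.
  apply: (itcomul_coderivation_factor (Y := glue_dgcoalg)
    (f := io) (g := io \oG chom e)).
    apply/comultE; rewrite (totm_comp io e) compA.
    by rewrite [tcomul _ ∘ totm io](glue_comul_io gl) -compA chom_tcomul tenA.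
  by apply/coderivationE; case: glue_homotopy.
have : io \oG pi +G ka \oG th = gid E :> ghom 0 E E.
  apply: totm_inj; rewrite totm_id -(gl_split gl) -(totm_comp io pi).
  by rewrite -(totm_comp ka th) -totm_add.
move=> /(congr1 (fun f : ghom 0 E E => f (i - 1) (i - 1))) /=.
rewrite !addr0 !subrK deltam_id => sE.
by rewrite -[u]compm1 -[v]compm1 -sE !compDr !compA uvio uvka.
Qed.

Definition glue_cogc : cogc V := Cogc glue_cocomplete.

Definition glue_in : cogc_hom Z glue_cogc :=
  @cogc_hom_of _ _ Z glue_cogc io (glue_d_io gl) (glue_comul_io gl).

End Object.

Lemma gluing_exists : exists (E : cogc V) (io : cogc_hom Z E)
  (ka : ghom (-1) Z E) (pi : ghom 0 E Z) (th : ghom 1 E Z),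
  is_gluing e io ka pi th /\ homotopyT io (io ∘C e) ka.
Proof.
have [E [io [ka [pi [th gl]]]]] := is_gluing_exists.
exists (glue_cogc gl), (glue_in gl), ka, pi, th.
by split=> //; apply: (glue_homotopy gl).
Qed.

End GluingExists.

(** * Morphisms out of the glued coalgebra *)

Section GluingProperties.
Variables (K : fieldType) (V : basecat K) (Z : cogc V) (e : cogc_hom Z Z).
Hypothesis eK : e ∘C e = e.
Variables (E : cogc V) (io : cogc_hom Z E) (ka : ghom (-1) Z E)
  (pi : ghom 0 E Z) (th : ghom 1 E Z).
Hypotheses (gl : is_gluing e io ka pi th) (kaP : homotopyT io (io ∘C e) ka).

Let dka : totm (cd E) ∘ totm ka
  = totm io - totm io ∘ totm e - totm ka ∘ totm (cd Z).
Proof. by rewrite -totm_cogc_comp -(hom_d kaP) addrK. Qed.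

Lemma glue_io_monic : cofibration io.
Proof.
move=> W u v _ _ /(congr1 (@totm _ _ _ _ _)).
rewrite (totm_comp io u) (totm_comp io v) => uv; apply: totm_inj.
by rewrite -[totm u]comp1m -[totm v]comp1m -(gl_pi_io gl) -!compA uv.
Qed.

(** The universal property of the glued coalgebra: h becomes the value of the
    extension on the adjoined homotopy. *)
Lemma glue_extend (Y : cogc V) (H : cogc_hom Z Y) (h : ghom (-1) Z Y) :
  homotopyT H (H ∘C e) h -> totm h ∘ totm e = 0 ->
  exists L : cogc_hom E Y, L ∘C io = H /\ totm L ∘ totm ka = totm h.
Proof.
move=> hP he.
pose L : ghom 0 E Y := chom H \oG pi +G h \oG th.
have LE : totm L = totm H ∘ totm pi + totm h ∘ totm th.
  by rewrite /L totm_add (totm_comp H pi) (totm_comp h th).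
have Li : totm L ∘ totm io = totm H.
  by rewrite LE compDl -!compA (gl_pi_io gl) (gl_th_io gl) compm0 compm1 addr0.
have Lk : totm L ∘ totm ka = totm h.
  rewrite LE compDl -!compA (gl_pi_ka gl) (gl_th_ka gl) compm0 add0r compDr.
  by rewrite compm1 compNr he subr0.
have Ld : totm (cd Y) ∘ totm L = totm L ∘ totm (cd E).
  apply: (glue_ext gl); rewrite -!compA.
    by rewrite Li !chom_totd compA Li.
  rewrite Lk dka !compDr !compNr !compA Li Lk -totm_cogc_comp.
  by rewrite -(hom_d hP) addrK.
have LD : tcomul (comul Y) ∘ totm L = (totm L ⊠ totm L) ∘ tcomul (comul E).
  apply: (glue_ext gl); rewrite -!compA.
    by rewrite Li !chom_tcomul tenA Li.
  rewrite Lk (hom_comul kaP) (hom_comul hP) !compA; congr (_ ∘ _).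
  by rewrite compDr -!tenmM !totm_cogc_comp !compA Li Lk.
exists (cogc_hom_of Ld LD); split=> //.
by apply: cogc_hom_inj; rewrite totm_cogc_comp.
Qed.

(** The extension q of p is zero on the adjoined summand: the zero homotopy goes
    from p to p e, since p e = p j p = p.  The homotopy ka pi from the identity of
    E to io j q moves Z along the adjoined summand onto the image of j, and kills
    that summand. *)
Lemma glue_retract (X : cogc V) (p : cogc_hom Z X) (j : cogc_hom X Z) :
  p ∘C j = cogc_id X -> e = j ∘C p ->
  exists q : cogc_hom E X, q ∘C io = p /\
    exists k : ghom (-1) E E, homotopyT (cogc_id E) ((io ∘C j) ∘C q) k.
Proof.
move=> pj eE.
have pe : p ∘C e = p.
  by rewrite eE; apply: cogc_hom_inj; rewrite !totm_cogc_comp compA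
    -totm_cogc_comp pj totm_cogc_id comp1m.
have [||q [qio qka]] := @glue_extend X p (gzero (-1) Z X).
- split; first by rewrite totm_zero tenm0 ten0m compm0 addr0 comp0m.
  by rewrite totm_zero compm0 comp0m addr0 pe subrr.
- by rewrite totm_zero comp0m.
rewrite totm_zero in qka.
exists q; split=> //; pose k : ghom (-1) E E := ka \oG pi; exists k.
have kE : totm k = totm ka ∘ totm pi := totm_comp ka pi.
have kio : totm k ∘ totm io = totm ka.
  by rewrite kE -compA (gl_pi_io gl) compm1.
have kka : totm k ∘ totm ka = 0 by rewrite kE -compA (gl_pi_ka gl) compm0.
have sio : totm ((io ∘C j) ∘C q) ∘ totm io = totm (io ∘C e).
  by rewrite -totm_cogc_comp eE !totm_cogc_comp -!compA -totm_cogc_comp qio.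
have ska : totm ((io ∘C j) ∘C q) ∘ totm ka = 0.
  by rewrite totm_cogc_comp -compA qka compm0.
have kae : totm ka ∘ totm e = 0 := ka_e gl.
split.
  apply: (glue_ext gl); rewrite -!compA ?kio ?kka ?compm0.
    rewrite (hom_comul kaP) chom_tcomul compA; congr (_ ∘ _).
    rewrite compDl -!tenmM kio sio; congr (_ ⊠ _ + _).
    by rewrite totm_cogc_id comp1m tsgn_totm0.
  rewrite (hom_comul kaP) compA compDl !compDr -!tenmM kka ska !tenm0 !ten0m.
  by rewrite totm_cogc_comp (compA (totm k)) kio kae tenm0 !addr0 comp0m.
apply: (glue_ext gl); rewrite compDl -!compA.
  by rewrite kio chom_totd (compA (totm k)) kio (hom_d kaP) compDl compNl sio
    totm_cogc_id comp1m.
rewrite kka compm0 add0r dka !compDr !compNr !(compA (totm k)) kio kka comp0m.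
by rewrite kae !subr0 compDl compNl ska subr0 totm_cogc_id comp1m.
Qed.

End GluingProperties.

(** * Derivations of the tensor algebra, one tensor factor at a time *)

(** The identities below are the inductive steps from a tensor power T of the
    desuspended coalgebra U to U ⊗ T.  Here s is the sign involution of U; a and b
    are the linear and quadratic parts of the cobar differential on U, and L and Q
    are those on T.  The mixed terms cancel because all these morphisms have odd
    degree. *)
Section TensorSteps.
Variables (K : fieldType) (V : basecat K).
Local Notation A := (assoc (bmon V)).

Section Differential.
Variables (U T : V) (s a : U ~> U) (b : U ~> U ⊗ U) (L : T ~> T) (Q : T ~> U ⊗ T).
Hypotheses (ss : s ∘ s = idm U) (sa : s ∘ a = - (a ∘ s)).
Hypothesis sb : (s ⊠ s) ∘ b = - (b ∘ s).

Lemma lin_lin_step : a ∘ a = 0 -> L ∘ L = 0 ->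
  (a ⊠ idm T + s ⊠ L) ∘ (a ⊠ idm T + s ⊠ L) = 0.
Proof.
move=> aa LL; rewrite compDl !compDr -!tenmM aa LL sa ten0m tenm0 add0r addr0.
by rewrite comp1m compm1 tenNl subrr.
Qed.

Lemma lin_quad_step :
  (a ⊠ idm U + s ⊠ a) ∘ b + b ∘ a = 0 ->
  (a ⊠ idm T + s ⊠ L) ∘ Q + Q ∘ L = 0 ->
  (a ⊠ idm (U ⊗ T) + s ⊠ (a ⊠ idm T + s ⊠ L))
      ∘ (A U U T ∘ (b ⊠ idm T) + s ⊠ Q)
    + (A U U T ∘ (b ⊠ idm T) + s ⊠ Q) ∘ (a ⊠ idm T + s ⊠ L) = 0.
Proof.
move=> ab LQ; rewrite -tenm1.
have abE : A U U T ∘ ((b ∘ a) ⊠ idm T)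
    = - (A U U T ∘ (((a ⊠ idm U) ∘ b) ⊠ idm T) + A U U T ∘ (((s ⊠ a) ∘ b) ⊠ idm T)).
  rewrite -compDr -tenDl -compDl -compNr -tenNl.
  by move/eqP: ab; rewrite addrC addr_eq0 => /eqP ->.
have LQE : idm U ⊠ (Q ∘ L)
    = - (idm U ⊠ ((a ⊠ idm T) ∘ Q) + idm U ⊠ ((s ⊠ L) ∘ Q)).
  rewrite -tenDr -compDl -tenNr.
  by move/eqP: LQ; rewrite addrC addr_eq0 => /eqP ->.
rewrite tenDr !compDl !compDr !(compA _ (A U U T)) -!(assoc_nat (bmon V)) -!compA.
rewrite -!tenmM !compm1 !comp1m sb ss sa abE LQE tenm1 comp1m !tenNl compNr.
by zmod_cancel.
Qed.

(** Coassociativity, expressed by the first hypothesis, is needed with the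
    bracketing U ⊗ (U ⊗ (U ⊗ T)); the pentagon brings it into that form. *)
Lemma quad_quad_step :
  A U U U ∘ ((b ⊠ idm U) ∘ b) + (s ⊠ b) ∘ b = 0 ->
  (A U U T ∘ (b ⊠ idm T) + s ⊠ Q) ∘ Q = 0 ->
  (A U U (U ⊗ T) ∘ (b ⊠ idm (U ⊗ T)) + s ⊠ (A U U T ∘ (b ⊠ idm T) + s ⊠ Q))
    ∘ (A U U T ∘ (b ⊠ idm T) + s ⊠ Q) = 0.
Proof.
move=> bb QQ; rewrite -tenm1.
have QQE : idm U ⊠ ((s ⊠ Q) ∘ Q) = - (idm U ⊠ (A U U T ∘ ((b ⊠ idm T) ∘ Q))).
  rewrite -tenNr; congr (_ ⊠ _); apply/eqP; rewrite -addr_eq0 addrC.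
  by rewrite compA -compDl QQ.
have bbE : (idm U ⊠ A U U T) ∘ (A U (U ⊗ U) T ∘ (((s ⊠ b) ∘ b) ⊠ idm T))
    = - (A U U (U ⊗ T) ∘ (A (U ⊗ U) U T ∘ (((b ⊠ idm U) ∘ b) ⊠ idm T))).
  move/eqP: bb; rewrite addrC addr_eq0 => /eqP ->.
  by rewrite tenNl !compNr (ten_compl _ (A U U U)) !compA pentagon.
have AE : (s ⊠ (A U U T ∘ (b ⊠ idm T))) ∘ (A U U T ∘ (b ⊠ idm T))
    = (idm U ⊠ A U U T) ∘ (A U (U ⊗ U) T ∘ (((s ⊠ b) ∘ b) ⊠ idm T)).
  rewrite -[s in LHS]comp1m tenmM -compA (compA _ (A U U T))
    -(assoc_nat (bmon V)).
  by rewrite -!compA -tenmM comp1m.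
rewrite tenDr !compDl !compDr AE bbE -!compA !(compA _ (A U U T)).
rewrite -!(assoc_nat (bmon V)) -!compA.
rewrite -!tenmM !compm1 sb ss -!compA QQE tenm1 comp1m !tenNl compNr.
by zmod_cancel.
Qed.

End Differential.

Section Morphism.
Variables (U U' T T' : V) (s a : U ~> U) (s' a' : U' ~> U').
Variables (b : U ~> U ⊗ U) (b' : U' ~> U' ⊗ U').
Variables (L : T ~> T) (Q : T ~> U ⊗ T) (L' : T' ~> T') (Q' : T' ~> U' ⊗ T').
Variables (f g h : U ~> U') (F G H : T ~> T').
Hypothesis sf : s' ∘ f = f ∘ s.

Lemma lin_hom_step : a' ∘ f = f ∘ a -> L' ∘ F = F ∘ L ->
  (a' ⊠ idm T' + s' ⊠ L') ∘ (f ⊠ F) = (f ⊠ F) ∘ (a ⊠ idm T + s ⊠ L).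
Proof.
move=> af LF; rewrite compDl compDr -!tenmM af LF sf.
by rewrite comp1m compm1.
Qed.

Lemma quad_hom_step : b' ∘ f = (f ⊠ f) ∘ b -> Q' ∘ F = (f ⊠ F) ∘ Q ->
  (A U' U' T' ∘ (b' ⊠ idm T') + s' ⊠ Q') ∘ (f ⊠ F)
  = (f ⊠ (f ⊠ F)) ∘ (A U U T ∘ (b ⊠ idm T) + s ⊠ Q).
Proof.
move=> bf QF; rewrite compDl compDr -!compA -!tenmM bf QF sf comp1m.
by rewrite compA -(assoc_nat (bmon V)) -compA -tenmM compm1.
Qed.

Hypotheses (ss : s ∘ s = idm U) (sh : s' ∘ h = - (h ∘ s)).

Lemma lin_homotopy_step :
  s ∘ a = - (a ∘ s) -> a' ∘ f = f ∘ a -> L' ∘ G = G ∘ L ->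
  a' ∘ h + h ∘ a = f - g -> L' ∘ H + H ∘ L = F - G ->
  (a' ⊠ idm T' + s' ⊠ L') ∘ ((f ∘ s) ⊠ H + h ⊠ G)
    + ((f ∘ s) ⊠ H + h ⊠ G) ∘ (a ⊠ idm T + s ⊠ L) = f ⊠ F - g ⊠ G.
Proof.
move=> sa af LG ah LH.
have ahE : (a' ∘ h) ⊠ G = (f - g) ⊠ G - (h ∘ a) ⊠ G.
  by rewrite -ah tenDl addrK.
have LHE : f ⊠ (L' ∘ H) = f ⊠ (F - G) - f ⊠ (H ∘ L) by rewrite -LH tenDr addrK.
rewrite !compDl !compDr -!tenmM !comp1m !compm1 (compA a') af (compA s') sf sh LG.
rewrite -!compA ss sa !compm1 compNr !tenNl ahE LHE !tenDl !tenDr tenNl tenNr.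
by zmod_cancel.
Qed.

(** The terms with b h cancel by the coderivation property, the others by the
    induction hypothesis and the signs of h and of b. *)
Lemma quad_homotopy_step :
  b' ∘ f = (f ⊠ f) ∘ b -> Q' ∘ G = (g ⊠ G) ∘ Q -> (s ⊠ s) ∘ b = - (b ∘ s) ->
  b' ∘ h + ((f ∘ s) ⊠ h + h ⊠ g) ∘ b = 0 ->
  Q' ∘ H + ((f ∘ s) ⊠ H + h ⊠ G) ∘ Q = 0 ->
  (A U' U' T' ∘ (b' ⊠ idm T') + s' ⊠ Q') ∘ ((f ∘ s) ⊠ H + h ⊠ G)
    + ((f ∘ s) ⊠ ((f ∘ s) ⊠ H + h ⊠ G) + h ⊠ (g ⊠ G))
        ∘ (A U U T ∘ (b ⊠ idm T) + s ⊠ Q) = 0.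
Proof.
move=> bf QG sb bh QH.
have bhE : A U' U' T' ∘ ((b' ∘ h) ⊠ G)
    = - (A U' U' T' ∘ ((((f ∘ s) ⊠ h) ∘ b) ⊠ G)
         + A U' U' T' ∘ (((h ⊠ g) ∘ b) ⊠ G)).
  rewrite -compDr -tenDl -compDl -compNr -tenNl.
  by move/eqP: bh; rewrite addr_eq0 => /eqP ->.
have QHE : f ⊠ (Q' ∘ H) = - (f ⊠ (((f ∘ s) ⊠ H) ∘ Q) + f ⊠ ((h ⊠ G) ∘ Q)).
  rewrite -tenDr -compDl -tenNr.
  by move/eqP: QH; rewrite addr_eq0 => /eqP ->.
have ffE : ((f ∘ s) ⊠ (f ∘ s)) ∘ b = - ((f ⊠ f) ∘ b ∘ s).
  by rewrite tenmM -compA sb compNr compA.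
rewrite tenDr !compDl !compDr !(compA _ (A U U T)) -!(assoc_nat (bmon V)) -!compA.
rewrite -!tenmM !comp1m !compm1 (compA s') sf sh (compA b') bf QG ffE.
rewrite -!compA ss !compm1 bhE QHE !tenNl compNr.
by zmod_cancel.
Qed.

End Morphism.

End TensorSteps.

(** * The cobar construction in total objects *)

Section CobarTot.
Variables (K : fieldType) (V : basecat K).

Section Desuspension.
Variable M : graded V.

Lemma sus_omega : totm (sus M) ∘ totm (omega M) = idm (tot M).
Proof.
apply: tot_ext => i; rewrite -compA (totmE _ erefl) compA.
rewrite (totmE (sus M) (j := i)) ?addrK //=.
by rewrite /desusp !tin_deltam ?addrK // comp1m.
Qed.

Lemma omega_sus : totm (omega M) ∘ totm (sus M) = idm (tot (desusp M)).
Proof.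
apply: tot_ext => i; rewrite -compA (totmE _ erefl) compA.
rewrite (totmE (omega M) (j := i)) ?subrK //=.
by rewrite !deltam_id !compm1 comp1m.
Qed.

End Desuspension.

Section Object.
Variable X : cogc V.
Local Notation W := (desusp X).
Local Notation "'s'" := (totm (sus X)).
Local Notation "'w'" := (totm (omega X)).
Local Notation "'d'" := (totm (cd X)).
Local Notation "'Δ'" := (tcomul (comul X)).
Local Notation "'τ'" := (tsgn _).
Local Notation A := (assoc (bmon V)).

Definition tlin n : tot (tpow W n) ~> tot (tpow W n) := totm (cobar_lin X n).
(** The quadratic part raises the number of tensor factors; the last tensor
    product of its target is already split. *)
Definition tquad n : tot (tpow W n) ~> tot W ⊗ tot (tpow W n) :=
  nu W (tpow W n) ∘ totm (cobar_quad X n).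

Lemma tlin0E : tlin 0 = - (w ∘ (d ∘ s)).
Proof.
rewrite /tlin [cobar_lin X 0]/= /cobar_d1 totm_opp.
by rewrite (totm_comp (omega X) (cd X \oG sus X)) (totm_comp (cd X) (sus X)).
Qed.

Lemma tquad0E : tquad 0 = - (((w ∘ τ) ⊠ w) ∘ (Δ ∘ s)).
Proof.
rewrite /tquad [cobar_quad X 0]/= /cobar_d2 totm_opp compNr.
rewrite (totm_comp (omega X ⊠G omega X) (comul X \oG sus X)).
by rewrite (totm_comp (comul X) (sus X)) !compA [tpow _ 0]/= nu_gtenm11 tcomulE
  -!compA.
Qed.

Lemma tlinS n :
  nu W (tpow W n) ∘ tlin n.+1
  = (tlin 0 ⊠ idm _ + τ ⊠ tlin n) ∘ nu W (tpow W n).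
Proof.
rewrite /tlin [cobar_lin X n.+1]/= totm_add compDr nu_gtenm10 nu_gtenm01.
by rewrite !totm_id comp1m compDl.
Qed.

Lemma tquadS n :
  (idm (tot W) ⊠ nu W (tpow W n)) ∘ tquad n.+1
  = (A (tot W) (tot W) (tot (tpow W n)) ∘ (tquad 0 ⊠ idm _) + τ ⊠ tquad n)
      ∘ nu W (tpow W n).
Proof.
rewrite /tquad [cobar_quad X n.+1]/= totm_add compDr nu_gtenm01.
rewrite (totm_comp (gassoc W W (tpow W n)) (cobar_d2 X ⊠G gid (tpow W n))).
rewrite compDr !compA -[_ ∘ _ ∘ totm (gassoc _ _ _)]compA nu_assoc -!compA.
by rewrite nu_gtenm10 compDl !tenA !totm_id !comp1m -!compA.
Qed.

Lemma twt : τ ∘ (w ∘ τ) = - w.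
Proof. by rewrite compA tsgn_totm1 compNl -compA tsgnK compm1. Qed.

Lemma tlin_tsgn n : τ ∘ tlin n = - (tlin n ∘ τ).
Proof. exact: tsgn_totm1. Qed.

Lemma tquad_tsgn : (τ ⊠ τ) ∘ tquad 0 = - (tquad 0 ∘ τ).
Proof.
by rewrite /tquad -compA -[_ ∘ tsgn _]opprK -tsgn_totm1 compNr opprK !compA
  nu_tsgn.
Qed.

Lemma tlin0_sq : tlin 0 ∘ tlin 0 = 0.
Proof.
rewrite tlin0E compNl compNr opprK -!compA (compA s) sus_omega comp1m.
by rewrite (compA d) totm_dd comp0m compm0.
Qed.

Lemma tquad0_tlin0 :
  (tlin 0 ⊠ idm (tot W) + τ ⊠ tlin 0) ∘ tquad 0 + tquad 0 ∘ tlin 0 = 0.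
Proof.
have sw := sus_omega X.
rewrite tquad0E tlin0E compNr compNl compNr opprK.
rewrite -!compA (compA s) sw comp1m (compA Δ) tcomul_d.
rewrite !compDl !compDr -!compA !tenA !compNl !tenNl !tenNr.
rewrite !comp1m -!compA !(compA s w) sw !compm1 comp1m.
rewrite twt tsgnK compm1 (tsgn_totm1 (cd X)) compNr !tenNl !compNl.
rewrite /=; zmod_cancel.
Qed.

Lemma tquad0_sq :
  A (tot W) (tot W) (tot W) ∘ ((tquad 0 ⊠ idm (tot W)) ∘ tquad 0)
    + (τ ⊠ tquad 0) ∘ tquad 0 = 0.
Proof.
have sw := sus_omega X.
rewrite tquad0E !tenNl !tenNr !compNl !compNr !opprK !tenA -!compA.
rewrite !(compA s w) !sw !comp1m compm1.
rewrite -tsgn_tcomul tenA -compA tsgnK compm1 twt.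
rewrite ten_compl (ten_compr _ _ _ Δ).
rewrite -!compA (compA (idm _ ⊠ Δ)) -tcomul_assoc -!compA tenNl compNl.
by rewrite (compA (A _ _ _) (_ ⊠ w)) (assoc_nat (bmon V)) -!compA subrr.
Qed.

Lemma tlin_sq n : tlin n ∘ tlin n = 0.
Proof.
elim: n => [|n IHn]; first exact: tlin0_sq.
apply: nu_mono; rewrite compA tlinS -compA tlinS compA.
by rewrite (lin_lin_step (tlin_tsgn 0) tlin0_sq IHn) comp0m compm0.
Qed.

Lemma tlin_tquad n :
  (tlin 0 ⊠ idm _ + τ ⊠ tlin n) ∘ tquad n + tquad n ∘ tlin n = 0.
Proof.
elim: n => [|n IHn]; first exact: tquad0_tlin0.
have lE : (idm (tot W) ⊠ nu W (tpow W n)) ∘ (tlin 0 ⊠ idm _ + τ ⊠ tlin n.+1)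
    = (tlin 0 ⊠ idm _ + τ ⊠ (tlin 0 ⊠ idm _ + τ ⊠ tlin n))
      ∘ (idm _ ⊠ nu W (tpow W n)).
  by rewrite compDr compDl -!tenmM !comp1m !compm1 tlinS.
apply: ten_nu_mono; rewrite compm0 compDr compA lE -compA tquadS.
rewrite (compA (idm _ ⊠ _) (tquad n.+1)) tquadS -(compA _ _ (tlin n.+1)) tlinS.
rewrite !compA -compDl.
by rewrite (lin_quad_step (tsgnK W) (tlin_tsgn 0) tquad_tsgn tquad0_tlin0 IHn)
  comp0m.
Qed.

Lemma tquad_sq n :
  (A (tot W) (tot W) (tot (tpow W n)) ∘ (tquad 0 ⊠ idm _) + τ ⊠ tquad n)
    ∘ tquad n = 0.
Proof.
elim: n => [|n IHn]; first by rewrite compDl -compA tquad0_sq.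
have qE : (idm (tot W) ⊠ (idm (tot W) ⊠ nu W (tpow W n)))
      ∘ (A (tot W) (tot W) (tot (tpow W n.+1)) ∘ (tquad 0 ⊠ idm _)
         + τ ⊠ tquad n.+1)
    = (A (tot W) (tot W) (tot W ⊗ tot (tpow W n)) ∘ (tquad 0 ⊠ idm _)
       + τ ⊠ (A (tot W) (tot W) (tot (tpow W n)) ∘ (tquad 0 ⊠ idm _) + τ ⊠ tquad n))
      ∘ (idm _ ⊠ nu W (tpow W n)).
  rewrite compDr compDl compA -(assoc_nat (bmon V)) -!compA -!tenmM !comp1m
    !compm1.
  by rewrite tenm1 comp1m tquadS.
(* The comparison stays monic after two more factors because it is split. *)
have [mu muK] := nu_split W (tpow W n).
have m2 (Y : V) (x : Y ~> tot W ⊗ (tot W ⊗ tot (tpow W n.+1))) :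
    (idm (tot W) ⊠ (idm (tot W) ⊠ nu W (tpow W n))) ∘ x = 0 -> x = 0.
  move=> /(congr1 (fun u => (idm (tot W) ⊠ (idm (tot W) ⊠ mu)) ∘ u)).
  by rewrite !tenA comp1m -tenmM comp1m muK !tenm1 comp1m compm0.
apply: m2; rewrite compA qE -compA tquadS compA.
by rewrite (quad_quad_step (tsgnK W) tquad_tsgn tquad0_sq IHn) comp0m.
Qed.

Lemma cobar_lin_lin n : cobar_lin X n \oG cobar_lin X n = gzero 2 _ _.
Proof. by apply/differentialE/tlin_sq. Qed.

Lemma cobar_lin_quad n :
  cobar_lin X n.+1 \oG cobar_quad X n +G cobar_quad X n \oG cobar_lin X n
  = gzero 2 _ _.
Proof.
apply: totm_inj; apply: nu_mono.
rewrite totm_add (totm_comp (cobar_lin X n.+1) (cobar_quad X n)) totm_zero compm0.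
rewrite (totm_comp (cobar_quad X n) (cobar_lin X n)) compDr !compA.
rewrite [X in X ∘ _ + _]tlinS -[X in X + _]compA; exact: (tlin_tquad n).
Qed.

Lemma cobar_quad_quad n : cobar_quad X n.+1 \oG cobar_quad X n = gzero 2 _ _.
Proof.
apply: totm_inj; apply: nu_mono; apply: ten_nu_mono.
rewrite (totm_comp (cobar_quad X n.+1) (cobar_quad X n)) totm_zero !compm0.
rewrite (compA (nu _ _)) compA [X in X ∘ _]tquadS -compA.
exact: tquad_sq.
Qed.

End Object.
End CobarTot.

(** * Morphisms and homotopies between tensor powers *)

Section CobarMorphisms.
Variables (K : fieldType) (V : basecat K) (X Y : cogc V).
Local Notation "'τ'" := (tsgn _).

Lemma totm_desuspm (f : cogc_hom X Y) :
  totm (desuspm f) = totm (omega Y) ∘ (totm f ∘ totm (sus X)).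
Proof.
apply: tot_ext => i; rewrite -!compA (totmE (desuspm f) (j := i)) ?addr0 //.
rewrite (totmE (sus X) (j := i - 1)) //= deltam_id compm1.
rewrite (totmE f (j := i - 1)) ?addr0 // compA.
by rewrite (totmE (omega Y) (j := i)) ?subrK //= deltam_id compm1.
Qed.

(** The sign compensates the one in the linear part of the cobar differential. *)
Definition desusp_homotopy (h : ghom (-1) X Y) : ghom (-1) (desusp X)
  (desusp Y) :=
  gopp (omega Y \oG (h \oG sus X)).

Lemma totm_desusp_homotopy (h : ghom (-1) X Y) :
  totm (desusp_homotopy h) = - (totm (omega Y) ∘ (totm h ∘ totm (sus X))).
Proof.
by rewrite totm_opp (totm_comp (omega Y) (h \oG sus X)) (totm_comp h (sus X)).
Qed.

Section Morphism.
Variable f : cogc_hom X Y.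
Local Notation F n := (totm (tpowm (desuspm f) n)).

Lemma tlin0_hom : tlin Y 0 ∘ F 0 = F 0 ∘ tlin X 0.
Proof.
rewrite [tpowm _ 0]/= totm_desuspm !tlin0E compNl compNr -!compA.
rewrite !(compA (totm (sus _)) (totm (omega _))) !sus_omega !comp1m.
by rewrite (compA (totm (cd Y))) chom_totd -!compA.
Qed.

Lemma tquad0_hom : tquad Y 0 ∘ F 0 = (F 0 ⊠ F 0) ∘ tquad X 0.
Proof.
rewrite [tpowm _ 0]/= totm_desuspm !tquad0E compNl compNr -!compA tenA -!compA.
rewrite !(compA (totm (sus _)) (totm (omega _))) !sus_omega !comp1m compm1.
rewrite (compA (tcomul _)) chom_tcomul -!compA tenA -!compA.
by rewrite tsgn_totm0.
Qed.

Lemma tlin_hom n : tlin Y n ∘ F n = F n ∘ tlin X n.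
Proof.
elim: n => [|n IHn]; first exact: tlin0_hom.
apply: nu_mono; rewrite !compA tlinS nu_tpowmS -!compA tlinS nu_tpowmS !compA.
by rewrite (lin_hom_step (tsgn_totm0 (desuspm f)) tlin0_hom IHn).
Qed.

Lemma tquad_hom n : tquad Y n ∘ F n = (F 0 ⊠ F n) ∘ tquad X n.
Proof.
elim: n => [|n IHn]; first exact: tquad0_hom.
apply: ten_nu_mono; rewrite compA tquadS -compA nu_tpowmS compA.
rewrite (quad_hom_step (tsgn_totm0 (desuspm f)) tquad0_hom IHn).
by rewrite tenA comp1m nu_tpowmS (ten_compr _ (F 0) (_ ⊠ _)) -!compA tquadS.
Qed.

Lemma cobar_lin_hom n :
  cobar_lin Y n \oG tpowm (desuspm f) n = tpowm (desuspm f) n \oG cobar_lin X n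
  :> ghom 1 _ _.
Proof. by apply/chain_mapE/tlin_hom. Qed.

Lemma cobar_quad_hom n :
  cobar_quad Y n \oG tpowm (desuspm f) n
  = tpowm (desuspm f) n.+1 \oG cobar_quad X n :> ghom 1 _ _.
Proof.
apply: totm_inj; apply: nu_mono.
rewrite (totm_comp (cobar_quad Y n) (tpowm (desuspm f) n)).
rewrite (totm_comp (tpowm (desuspm f) n.+1) (cobar_quad X n)) !compA.
rewrite [X in _ = X ∘ _]nu_tpowmS -[RHS]compA; exact: (tquad_hom n).
Qed.

End Morphism.

Section Homotopy.
Variables (f g : cogc_hom X Y) (h : ghom (-1) X Y).
Hypothesis hP : homotopyT f g h.
Local Notation F n := (totm (tpowm (desuspm f) n)).
Local Notation G n := (totm (tpowm (desuspm g) n)).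
Local Notation Hg n := (hpow (desuspm f) (desuspm g) (desusp_homotopy h) n).
Local Notation H n := (totm (Hg n)).

Lemma tlin0_homotopy : tlin Y 0 ∘ H 0 + H 0 ∘ tlin X 0 = F 0 - G 0.
Proof.
rewrite [hpow _ _ _ 0]/= ![tpowm _ 0]/= !totm_desuspm totm_desusp_homotopy
  !tlin0E.
rewrite !compNl !compNr !opprK -!compA.
rewrite !(compA (totm (sus _)) (totm (omega _))) !sus_omega !comp1m.
rewrite -compNr -!compDr; congr (_ ∘ _).
by rewrite -compNl -compDl !compA -compDl (hom_d hP).
Qed.

Lemma tquad0_homotopy :
  tquad Y 0 ∘ H 0 + ((F 0 ∘ τ) ⊠ H 0 + H 0 ⊠ G 0) ∘ tquad X 0 = 0.
Proof.
rewrite [hpow _ _ _ 0]/= ![tpowm _ 0]/= !totm_desuspm totm_desusp_homotopy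
  !tquad0E.
rewrite !compNl !compNr !tenNl !tenNr !opprK -!compA.
rewrite !(compA (totm (sus _)) (totm (omega _))) !sus_omega !comp1m.
rewrite (compA (tcomul _)) (hom_comul hP) -!compA.
rewrite !compDl !compDr !compNl !tenA -!compA !twt !compNr.
rewrite !(compA (totm (sus _)) (totm (omega _))) !sus_omega !comp1m !compm1.
rewrite (compA τ (totm f)) tsgn_totm0 (tsgn_totmN1 h) -!compA tsgnK compm1
  !compNr.
rewrite !tenNl !compNl.
by rewrite opprK subrr.
Qed.

Lemma tlin_homotopy n : tlin Y n ∘ H n + H n ∘ tlin X n = F n - G n.
Proof.
elim: n => [|n IHn]; first exact: tlin0_homotopy.
apply: nu_mono; rewrite compDr !compA tlinS nu_hpowS -!compA nu_hpowS tlinS.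
rewrite !compA -compDl.
rewrite (lin_homotopy_step (tsgn_totm0 (desuspm f)) (tsgnK _)
  (tsgn_totmN1 (desusp_homotopy h)) (tlin_tsgn X 0) (tlin0_hom f) (tlin_hom g n)
  tlin0_homotopy IHn).
by rewrite compDl compNl compDr compNr !nu_tpowmS.
Qed.

Lemma tquad_homotopy n :
  tquad Y n ∘ H n + ((F 0 ∘ τ) ⊠ H n + H 0 ⊠ G n) ∘ tquad X n = 0.
Proof.
elim: n => [|n IHn]; first exact: tquad0_homotopy.
have sE : (idm (tot (desusp Y)) ⊠ nu (desusp Y) (tpow (desusp Y) n))
      ∘ ((F 0 ∘ τ) ⊠ H n.+1 + H 0 ⊠ G n.+1)
    = ((F 0 ∘ τ) ⊠ ((F 0 ∘ τ) ⊠ H n + H 0 ⊠ G n) + H 0 ⊠ (G 0 ⊠ G n))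
      ∘ (idm _ ⊠ nu (desusp X) (tpow (desusp X) n)).
  by rewrite compDr compDl -!tenmM !comp1m !compm1 nu_hpowS nu_tpowmS.
apply: ten_nu_mono; rewrite compm0 compDr compA tquadS.
rewrite -(compA _ _ (H n.+1)) nu_hpowS (compA _ _ (tquad X n.+1)) sE.
rewrite -(compA _ _ (tquad X n.+1)) tquadS !(compA _ _ (nu _ _)) -compDl.
by rewrite (quad_homotopy_step (tsgn_totm0 (desuspm f)) (tsgnK _)
  (tsgn_totmN1 (desusp_homotopy h)) (tquad0_hom f) (tquad_hom g n) (tquad_tsgn X)
  tquad0_homotopy IHn) comp0m.
Qed.

Lemma cobar_lin_homotopy n :
  cobar_lin Y n \oG Hg n +G Hg n \oG cobar_lin X n
  = tpowm (desuspm f) n +G gopp (tpowm (desuspm g) n) :> ghom 0 _ _.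
Proof. by apply/homotopyE/tlin_homotopy. Qed.

Lemma cobar_quad_homotopy n :
  cobar_quad Y n \oG Hg n +G Hg n.+1 \oG cobar_quad X n = gzero 0 _ _.
Proof.
apply: totm_inj; apply: nu_mono.
rewrite (totm_add (p := 0)) (totm_comp (cobar_quad Y n) (Hg n)) totm_zero compm0.
rewrite (totm_comp (Hg n.+1) (cobar_quad X n)) compDr !compA.
rewrite [X in _ + X ∘ _]nu_hpowS -[X in _ + X]compA; exact: (tquad_homotopy n).
Qed.

End Homotopy.
End CobarMorphisms.

(** * The cobar complex *)

Section CobarComplex.
Variables (K : fieldType) (V : basecat K).

Lemma cobar_ext (X : cogc V) i (Y : V) (u v : cobar X i ~> Y) :
  (forall n, u ∘ cobar_in X n i = v ∘ cobar_in X n i) -> u = v.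
Proof. exact: (coprod_ext (A := fun n => tpow (desusp X) n i)). Qed.

Lemma cobar_d_in (X : cogc V) i j n :
  cobar_d X i j ∘ cobar_in X n i
  = cobar_in X n j ∘ cobar_lin X n i j + cobar_in X n.+1 j ∘ cobar_quad X n i j.
Proof. exact: (coprod_descE (A := fun n => tpow (desusp X) n i)). Qed.

Lemma cobarm_in (X Y : cogc V) (f : cogc_hom X Y) i j n :
  cobarm f i j ∘ cobar_in X n i = cobar_in Y n j ∘ tpowm (desuspm f) n i j.
Proof. exact: (coprod_descE (A := fun n => tpow (desusp X) n i)). Qed.

(** The components of the square of the differential, ordered by the number of
    added tensor factors, are the square of the linear part, the anticommutator of
    the two parts and the square of the quadratic part. *)
Lemma cobar_dd (X : cogc V) : cobar_d X \oG cobar_d X = gzero 2 _ _.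
Proof.
apply: ghom_eqP => i j; apply: cobar_ext => n; rewrite comp0m /= -compA
  cobar_d_in.
rewrite compDr !compA !cobar_d_in !compDl -!compA.
have eqE m m' (u v : ghom 2 (tpow (desusp X) m) (tpow (desusp X) m')) :
  u = v -> u i j = v i j by move=> ->.
have /= -> := eqE _ _ _ _ (cobar_lin_lin X n).
have /= -> := eqE _ _ _ _ (cobar_quad_quad X n).
rewrite !compm0 add0r addr0 -compDr.
have /= := eqE _ _ _ _ (cobar_lin_quad X n).
by rewrite addrC => ->; rewrite compm0.
Qed.

Lemma cobarm_d (X Y : cogc V) (f : cogc_hom X Y) :
  cobar_d Y \oG cobarm f = cobarm f \oG cobar_d X :> ghom 1 _ _.
Proof.
apply: ghom_eqP => i j; apply: cobar_ext => n; rewrite /= -!compA cobar_d_in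
  cobarm_in.
rewrite compDr !compA cobar_d_in !cobarm_in !compDl -!compA.
have eqE m m' (u v : ghom 1 (tpow (desusp X) m) (tpow (desusp Y) m')) :
  u = v -> u i j = v i j by move=> ->.
have /= -> := eqE _ _ _ _ (cobar_lin_hom f n).
by have /= -> := eqE _ _ _ _ (cobar_quad_hom f n).
Qed.

Lemma cobarm_homotopy (X Y : cogc V) (f g : cogc_hom X Y) (h : ghom (-1) X Y) :
  homotopyT f g h ->
  exists H : ghom (-1) (cobar X) (cobar Y),
    cobar_d Y \oG H +G H \oG cobar_d X = cobarm f +G gopp (cobarm g) :> ghom 0 _ _.
Proof.
move=> hP; pose Hg n := hpow (desuspm f) (desuspm g) (desusp_homotopy h) n.
pose mx i j := coprod_desc (A := fun n => tpow (desusp X) n i)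
  (fun n => cobar_in Y n j ∘ Hg n i j).
have mxE i j n : mx i j ∘ cobar_in X n i = cobar_in Y n j ∘ Hg n i j.
  exact: (coprod_descE (A := fun n => tpow (desusp X) n i)).
have mx0 i j : j != i - 1 -> mx i j = 0.
  by move=> ij; apply: cobar_ext => n; rewrite comp0m mxE gmxP ?compm0.
exists (GHom mx0); apply: ghom_eqP => i j; apply: cobar_ext => n.
rewrite /= !compDl !compNl -!compA mxE !cobar_d_in !cobarm_in.
rewrite compDr !compA cobar_d_in !mxE !compDl -!compA.
have eqE m m' (u v : ghom 0 (tpow (desusp X) m) (tpow (desusp Y) m')) :
  u = v -> u i j = v i j by move=> ->.
have /= linE := eqE _ _ _ _ (cobar_lin_homotopy hP n).
have /= quadE := eqE _ _ _ _ (cobar_quad_homotopy hP n).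
by rewrite addrACA -!compDr linE quadE compm0 addr0 compDr compNr.
Qed.

Lemma tpowm_comp (M N P : graded V) (g : ghom 0 N P) (f : ghom 0 M N) n :
  tpowm (g \oG f : ghom 0 M P) n = tpowm g n \oG tpowm f n :> ghom 0 _ _.
Proof.
elim: n => //= n IHn; rewrite IHn.
exact: gtenm0M.
Qed.

Lemma tpowm_id (M : graded V) n : tpowm (gid M) n = gid (tpow M n).
Proof. by elim: n => //= n ->; apply: gtenm11. Qed.

Lemma cobarm_comp (X Y Z : cogc V) (g : cogc_hom Y Z) (f : cogc_hom X Y) :
  cobarm (g ∘C f) = cobarm g \oG cobarm f.
Proof.
have dE : desuspm (g ∘C f) = desuspm g \oG desuspm f.
  apply: totm_inj; rewrite (totm_comp (desuspm g) (desuspm f)) !totm_desuspm.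
  rewrite totm_cogc_comp -!compA (compA (totm (sus _)) (totm (omega _))).
  by rewrite sus_omega comp1m.
apply: ghom_eqP => i j; apply: cobar_ext => n.
rewrite [in RHS]/= -compA !cobarm_in compA cobarm_in dE.
by rewrite (tpowm_comp (desuspm g) (desuspm f)) /= compA.
Qed.

Lemma cobarm_id (X : cogc V) : cobarm (cogc_id X) = gid (cobar X).
Proof.
have dE : desuspm (cogc_id X) = gid (desusp X).
  apply: totm_inj; rewrite totm_desuspm totm_cogc_id totm_id comp1m.
  exact: omega_sus.
apply: ghom_eqP => i j; apply: cobar_ext => n; rewrite cobarm_in dE tpowm_id.
have [->|ij] := eqVneq j (i + 0); last by rewrite !gmxP // compm0 comp0m.
by rewrite addr0 /= !deltam_id compm1 comp1m.
Qed.

End CobarComplex.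

(** * Quasi-isomorphisms *)

Section QuasiIso.
Variables (K : fieldType) (V : basecat K).

(** A morphism of complexes induces h on cohomology; a relation, since the
    cohomology data are not chosen functorially. *)
Definition induced (M N : graded V) (dM : ghom 1 M M) (dN : ghom 1 N N) i
    (HM : cohomology dM i) (HN : cohomology dN i) (f : ghom 0 M N)
    (h : coh_H HM ~> coh_H HN) :=
  exists2 z : coh_Z HM ~> coh_Z HN,
    coh_k HN ∘ z = f i i ∘ coh_k HM & h ∘ coh_q HM = coh_q HN ∘ z.

Lemma cohomology_exists (M : graded V) (d : ghom 1 M M) i :
  d \oG d = gzero 2 M M -> exists _ : cohomology d i, True.
Proof.
move=> dd; have ddi : d i (i + 1) ∘ d (i - 1) i = 0.
  have := congr1 (fun u : ghom 2 M M => u (i - 1) (i + 1)) dd.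
  by rewrite /= subrK.
have [Z [k kP]] := ab_kernel (bcat_abelian V) (d i (i + 1)).
have [b [bE _]] := proj2 kP _ _ ddi.
have [H [q qP]] := ab_cokernel (bcat_abelian V) b.
by exists (Cohomology kP bE qP).
Qed.

Lemma cohomology_exact (M : graded V) (d : ghom 1 M M) i (HM : cohomology d i) :
  coh_q HM ∘ coh_b HM = 0.
Proof. by case: (coh_qP HM). Qed.

Section Induced.
Variables (M N : graded V) (dM : ghom 1 M M) (dN : ghom 1 N N) (i : int).
Variables (HM : cohomology dM i) (HN : cohomology dN i).

Lemma induced_exists (f : ghom 0 M N) :
  dN \oG f = f \oG dM :> ghom 1 M N -> exists h, induced (HM := HM) (HN := HN) f h.
Proof.
move=> fd.
have fdE a b : dN a b ∘ f a a = f b b ∘ dM a b.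
  have [->|ab] := eqVneq b (a + 1); last first.
    by rewrite (gmxP dN) // (gmxP dM) // compm0 comp0m.
  have := congr1 (fun u : ghom 1 M N => u a (a + 1)) fd.
  by rewrite /= !addr0.
have [z [zE _]] : exists! z, coh_k HN ∘ z = f i i ∘ coh_k HM.
  apply: (proj2 (coh_kP HN)).
  by rewrite compA fdE -compA (proj1 (coh_kP HM)) compm0.
have zb : z ∘ coh_b HM = coh_b HN ∘ f (i - 1) (i - 1).
  apply: (kernel_monic (coh_kP HN)).
  by rewrite !compA zE coh_bP -compA coh_bP fdE.
have [h [hE _]] : exists! h, h ∘ coh_q HM = coh_q HN ∘ z.
  by apply: (proj2 (coh_qP HM)); rewrite -compA zb compA cohomology_exact comp0m.
by exists h, z.
Qed.

(** A homotopy between f and g factors the difference of the induced maps on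
    cocycles through the coboundaries. *)
Lemma induced_homotopic (f g : ghom 0 M N) (s : ghom (-1) M N) hf hg :
  dN \oG s +G s \oG dM = f +G gopp g :> ghom 0 M N ->
  induced (HM := HM) (HN := HN) f hf -> induced (HM := HM) (HN := HN) g hg -> hf = hg.
Proof.
move=> fg [zf zfE hfE] [zg zgE hgE].
have := congr1 (fun u : ghom 0 M N => u i i) fg; rewrite /= => fgE.
have zE : zf - zg = coh_b HN ∘ (s i (i - 1) ∘ coh_k HM).
  apply: (kernel_monic (coh_kP HN)).
  rewrite compDr compNr zfE zgE -compNl -compDl -fgE compDl.
  rewrite -(compA (s _ _)) (proj1 (coh_kP HM)) compm0 addr0.
  by rewrite compA coh_bP compA.
apply: (cokernel_epic (coh_qP HM)); rewrite hfE hgE; apply/eqP; rewrite -subr_eq0.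
by rewrite -compNr -compDr zE compA cohomology_exact comp0m.
Qed.

Lemma induced_unique (f : ghom 0 M N) h h' :
  induced (HM := HM) (HN := HN) f h -> induced (HM := HM) (HN := HN) f h' -> h = h'.
Proof.
apply: (induced_homotopic (s := gzero (-1) M N)); apply: ghom_eqP => a b /=.
by rewrite compm0 comp0m addr0 subrr.
Qed.

End Induced.

Lemma induced_comp (M N P : graded V) (dM : ghom 1 M M) (dN : ghom 1 N N)
    (dP : ghom 1 P P) i (HM : cohomology dM i) (HN : cohomology dN i)
    (HP : cohomology dP i) (f : ghom 0 M N) (g : ghom 0 N P) hf hg :
  induced (HM := HM) (HN := HN) f hf -> induced (HM := HN) (HN := HP) g hg ->
  induced (HM := HM) (HN := HP) (g \oG f : ghom 0 M P) (hg ∘ hf).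
Proof.
move=> [zf zfE hfE] [zg zgE hgE]; exists (zg ∘ zf).
  by rewrite compA zgE -compA zfE gcomp0E compA.
by rewrite -compA hfE compA hgE compA.
Qed.

Lemma induced_id (M : graded V) (dM : ghom 1 M M) i (HM : cohomology dM i) :
  induced (HM := HM) (HN := HM) (gid M) (idm _).
Proof. by exists (idm _); rewrite ?comp1m ?compm1 //= deltam_id comp1m. Qed.

(** Any two choices of cohomology data are identified by the maps that the
    identity induces. *)
Lemma quasi_iso_induced (M N : graded V) (dM : ghom 1 M M) (dN : ghom 1 N N)
    (f : ghom 0 M N) i (HM : cohomology dM i) (HN : cohomology dN i) h :
  quasi_iso dM dN f -> induced (HM := HM) (HN := HN) f h -> is_iso h.
Proof.
move=> fq fh; have [HM' [HN' [z0 [h0 [z0E h0E [g0 [gh hg]]]]]]] := fq i.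
have fh0 : induced (HM := HM') (HN := HN') f h0 by exists z0.
have idE (L : graded V) (dL : ghom 1 L L) : dL \oG gid L = gid L \oG dL :> ghom
  1 L L.
  by apply: ghom_eqP => a b; rewrite gcomp1g gcompg1.
have [a aP] := induced_exists HM HM' (idE _ dM).
have [a' a'P] := induced_exists HM' HM (idE _ dM).
have [b bP] := induced_exists HN HN' (idE _ dN).
have [b' b'P] := induced_exists HN' HN (idE _ dN).
have idid (L : graded V) : gid L \oG gid L = gid L by apply: ghom_eqP => x y;
  rewrite gcomp1g.
have idf : gid N \oG f = f by apply: ghom_eqP => x y; rewrite gcomp1g.
have fid : f \oG gid M = f by apply: ghom_eqP => x y; rewrite gcompg1.
have a'a : a' ∘ a = idm _.
  have := induced_comp aP a'P; rewrite idid.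
  by move=> /induced_unique; apply; apply: induced_id.
have bb' : b' ∘ b = idm _.
  have := induced_comp bP b'P; rewrite idid.
  by move=> /induced_unique; apply; apply: induced_id.
have bh : b ∘ h = h0 ∘ a.
  have := induced_comp fh bP; rewrite idf => /induced_unique; apply.
  by have := induced_comp aP fh0; rewrite fid.
have ha' : h ∘ a' = b' ∘ h0.
  have := induced_comp a'P fh; rewrite fid => /induced_unique; apply.
  by have := induced_comp fh0 b'P; rewrite idf.
exists (a' ∘ (g0 ∘ b)); split.
  by rewrite -!compA bh (compA g0) gh comp1m.
by rewrite !compA ha' -!compA (compA h0) hg comp1m.
Qed.

Lemma quasi_iso_retract (M N : graded V) (dM : ghom 1 M M) (dN : ghom 1 N N)
    (f : ghom 0 M N) (g : ghom 0 N M) (s : ghom (-1) M M) :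
  dM \oG dM = gzero 2 M M -> dN \oG dN = gzero 2 N N ->
  dN \oG f = f \oG dM :> ghom 1 M N -> dM \oG g = g \oG dN :> ghom 1 N M ->
  f \oG g = gid N ->
  dM \oG s +G s \oG dM = gid M +G gopp (g \oG f) :> ghom 0 M M ->
  quasi_iso dM dN f.
Proof.
move=> ddM ddN fd gd fg gf i.
have [HM _] := cohomology_exists i ddM; have [HN _] := cohomology_exists i ddN.
have [hf hfP] := induced_exists HM HN fd.
have [hg hgP] := induced_exists HN HM gd.
have [z zE hE] := hfP; exists HM, HN, z, hf; split=> //; exists hg; split.
  exact/esym/(induced_homotopic gf (induced_id HM) (induced_comp hfP hgP)).
have := induced_comp hgP hfP; rewrite fg => /induced_unique; apply.
exact: induced_id.
Qed.

Lemma quasi_iso_cancel (M N P : graded V) (dM : ghom 1 M M) (dN : ghom 1 N N)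
    (dP : ghom 1 P P) (f : ghom 0 M N) (g : ghom 0 N P) :
  dM \oG dM = gzero 2 M M -> dN \oG dN = gzero 2 N N -> dP \oG dP = gzero 2 P P ->
  dN \oG f = f \oG dM :> ghom 1 M N -> dP \oG g = g \oG dN :> ghom 1 N P ->
  quasi_iso dN dP g -> quasi_iso dM dP (g \oG f) -> quasi_iso dM dN f.
Proof.
move=> ddM ddN ddP fd gd gq gfq i.
have [HM _] := cohomology_exists i ddM; have [HN _] := cohomology_exists i ddN.
have [HP _] := cohomology_exists i ddP.
have [hf hfP] := induced_exists HM HN fd.
have [hg hgP] := induced_exists HN HP gd.
have [z zE hE] := hfP; exists HM, HN, z, hf; split=> //.
have [a [ag ga]] := quasi_iso_induced gq hgP.
have [b [bgf gfb]] := quasi_iso_induced gfq (induced_comp hfP hgP).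
exists (b ∘ hg); split; first by rewrite -compA.
rewrite -[LHS]comp1m -ag -compA; congr (_ ∘ _).
by rewrite compA compA gfb comp1m.
Qed.

End QuasiIso.

(** * Weak equivalences of coalgebras *)

Section WeakEquivalences.
Variables (K : fieldType) (V : basecat K).

Lemma weak_equivalence_cancel (X Y Z : cogc V) (f : cogc_hom X Y)
  (g : cogc_hom Y Z) :
  weak_equivalence g -> weak_equivalence (g ∘C f) -> weak_equivalence f.
Proof.
rewrite /weak_equivalence cobarm_comp => gq gfq.
exact: (quasi_iso_cancel (cobar_dd X) (cobar_dd Y) (cobar_dd Z) (cobarm_d f)
  (cobarm_d g) gq gfq).
Qed.

Lemma weak_equivalence_retract (X Y : cogc V) (f : cogc_hom X Y)
  (g : cogc_hom Y X)
    (h : ghom (-1) X X) :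
  f ∘C g = cogc_id Y -> homotopyT (cogc_id X) (g ∘C f) h -> weak_equivalence f.
Proof.
move=> fg /cobarm_homotopy [s]; rewrite cobarm_id cobarm_comp => sP.
apply: (quasi_iso_retract (cobar_dd X) (cobar_dd Y) (cobarm_d f) (cobarm_d g) _ sP).
by rewrite -cobarm_comp fg cobarm_id.
Qed.

End WeakEquivalences.

(** * Classical and left homotopies *)

Section Main.
Variables (K : fieldType) (V : basecat K).

(** The cylinder is glued from the coproduct of C with itself along the
    idempotent that moves the first copy onto the second, so the adjoined summand
    is the suspension of C. *)
Lemma classical_left_homotopic (C C' : cogc V) (f g : cogc_hom C C') :
  classically_homotopic f g -> left_homotopic f g.
Proof.
move=> /classically_homotopicE [h hP].
have [S [i1 [i2 [p1 [p2 [copS sumS]]]]]] := cogc_coproduct_exists C C.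
have [p [[pi1 pi2] _]] := copS C (cogc_id C) (cogc_id C).
have [H [[Hi1 Hi2] _]] := copS C' f g.
pose e := i2 ∘C p.
have eK : e ∘C e = e.
  apply: cogc_hom_inj; rewrite !totm_cogc_comp -compA (compA (totm p)).
  by rewrite -totm_cogc_comp pi2 totm_cogc_id comp1m.
have [E [io [ka [pi [th [gl kaP]]]]]] := gluing_exists eK.
have [q [qio [k kP]]] := glue_retract gl kaP pi2 erefl.
have qi2 : q ∘C (io ∘C i2) = cogc_id C.
  by rewrite -pi2 -qio; apply: cogc_hom_inj; rewrite !totm_cogc_comp compA.
have qw : weak_equivalence q := weak_equivalence_retract qi2 kP.
have qi a : p ∘C a = cogc_id C -> (q ∘C io) ∘C a = cogc_id C by rewrite qio.
exists (Cylinder copS qw (qi _ pi1) (qi _ pi2)).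
(* Zero on the second copy, where H and H e both restrict to g. *)
pose hS : ghom (-1) S C' := h \oG p1.
have hSE : totm hS = totm h ∘ totm p1 := totm_comp h p1.
have hS1 : totm hS ∘ totm i1 = totm h.
  by rewrite hSE -compA (gs_11 sumS) compm1.
have hS2 : totm hS ∘ totm i2 = 0 by rewrite hSE -compA (gs_12 sumS) compm0.
have tH1 : totm H ∘ totm i1 = totm f by rewrite -totm_cogc_comp Hi1.
have tH2 : totm H ∘ totm i2 = totm g by rewrite -totm_cogc_comp Hi2.
have tHe1 : totm (H ∘C e) ∘ totm i1 = totm g.
  by rewrite /e !totm_cogc_comp compA tH2 -compA -totm_cogc_comp pi1
    totm_cogc_id compm1.
have tHe2 : totm (H ∘C e) ∘ totm i2 = totm g.
  by rewrite /e !totm_cogc_comp compA tH2 -compA -totm_cogc_comp pi2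
    totm_cogc_id compm1.
have hSP : homotopyT H (H ∘C e) hS.
  split; apply: (sum_ext sumS).
  - rewrite -!compA hS1 (hom_comul hP) chom_tcomul compA; congr (_ ∘ _).
    by rewrite compDl -!tenmM hS1 tHe1 -compA tsgn_totm0 compA tH1.
  - rewrite -!compA hS2 compm0 chom_tcomul compA compDl -!tenmM hS2 tenm0 ten0m.
    by rewrite addr0 comp0m.
  - rewrite !compDl compNl -!compA hS1 chom_totd (compA (totm hS)) hS1 (hom_d hP).
    by rewrite tH1 tHe1.
  - rewrite !compDl compNl -!compA hS2 chom_totd (compA (totm hS)) hS2 compm0
      comp0m.
    by rewrite tH2 tHe2 subrr addr0.
have [|L [Lio _]] := glue_extend gl kaP hSP.
  by rewrite /e totm_cogc_comp compA hS2 comp0m.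
exists L => /=; rewrite Lio; split; first exact: Hi1.
exact: Hi2.
Qed.

Lemma homotopyT_comp (X Y Z : cogc V) (u : cogc_hom X Y) (v w : cogc_hom Y Z)
    (h : ghom (-1) Y Z) :
  homotopyT v w h ->
  exists k : ghom (-1) X Z, homotopyT (v ∘C u) (w ∘C u) k.
Proof.
move=> hP; exists (h \oG chom u); split; rewrite !totm_cogc_comp (totm_comp h u).
  rewrite compA (hom_comul hP) -compA chom_tcomul compA compDl -!tenmM.
  by rewrite -!(compA (totm v)) tsgn_totm0.
by rewrite compA -(compA _ (totm u)) -chom_totd compA -compDl (hom_d hP) compDl
  compNl.
Qed.

Lemma homotopyT_postcomp (X Y Z : cogc V) (u v : cogc_hom X Y) (w : cogc_hom Y Z)
    (h : ghom (-1) X Y) :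
  homotopyT u v h ->
  exists k : ghom (-1) X Z, homotopyT (w ∘C u) (w ∘C v) k.
Proof.
move=> hP; exists (chom w \oG h); split; rewrite !totm_cogc_comp (totm_comp w h).
  rewrite compA chom_tcomul -compA (hom_comul hP) compA compDr -!tenmM.
  by rewrite !compA.
by rewrite compA chom_totd -!compA -compDr (hom_d hP) compDr compNr.
Qed.

(** The inclusion io of the cylinder object Z in the glued coalgebra is a weak
    equivalence, whether or not the ends of the cylinder form a cofibration. *)
Lemma left_classical_homotopic (C C' : cogc V) (f g : cogc_hom C C') :
  fibrant C' -> left_homotopic f g -> classically_homotopic f g.
Proof.
move=> [T [t [Tterm tfib]]] [[S i1 i2 copS Z i p pw pi1 pi2] [H /= [Hi1 Hi2]]].
have [j jE] : exists j, j = i ∘C i2 by eexists.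
pose e := j ∘C p.
have pj : p ∘C j = cogc_id C.
  by rewrite -pi2 jE; apply: cogc_hom_inj; rewrite !totm_cogc_comp compA.
have eK : e ∘C e = e.
  apply: cogc_hom_inj; rewrite !totm_cogc_comp -compA (compA (totm p)).
  by rewrite -totm_cogc_comp pj totm_cogc_id comp1m.
have [E [io [ka [pi [th [gl kaP]]]]]] := gluing_exists eK.
have [q [qio [k kP]]] := glue_retract gl kaP pj erefl.
have qj : q ∘C (io ∘C j) = cogc_id C.
  by rewrite -pj -qio; apply: cogc_hom_inj; rewrite !totm_cogc_comp compA.
have qw : weak_equivalence q := weak_equivalence_retract qj kP.
have iow : weak_equivalence io.
  by apply: (weak_equivalence_cancel qw); rewrite qio.
have [v _] := Tterm E.
have [tv [_ tvU]] := Tterm Z.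
have [|L [Lio _]] := tfib _ _ io H v (glue_io_monic gl) iow.
  by rewrite -(tvU (t ∘C H)) // -(tvU (v ∘C io)).
have [h1] := homotopyT_postcomp L kaP.
rewrite Lio => /(homotopyT_comp (i ∘C i1)) [h hP].
apply/classically_homotopicE; exists h.
have fE : H ∘C (i ∘C i1) = f.
  by rewrite -Hi1; apply: cogc_hom_inj; rewrite !totm_cogc_comp compA.
have gE : (L ∘C (io ∘C e)) ∘C (i ∘C i1) = g.
  rewrite -Hi2 -Lio; apply: cogc_hom_inj; rewrite /e jE !totm_cogc_comp -!compA.
  have := congr1 (fun u : cogc_hom C C => totm u) pi1.
  by rewrite totm_cogc_id !totm_cogc_comp -compA => ->; rewrite compm1.
by move: hP; rewrite fE gE.
Qed.

End Main.

Theorem proposition1p3p4p1 (K : fieldType) (V : basecat K) (C C' : cogc V)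
    (f g : cogc_hom C C') :
  (classically_homotopic f g -> left_homotopic f g) /\
  (fibrant C' -> (classically_homotopic f g <-> left_homotopic f g)).
Proof.
split=> [|C'fib]; first exact: classical_left_homotopic.
split; first exact: classical_left_homotopic.
exact: left_classical_homotopic.
Qed.
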